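(* For any Perron eigenvector $\pi\in\Pi$, the $\theta$-related error exponent $\Phi(\pi,\theta)$ satisfies $$\min_{k\in\mathcal N}\Phi_k^{\mathsf{nc}}(\theta)\le\Phi(\pi,\theta)\le\sum_{k=1}^N\Phi_k^{\mathsf{nc}}(\theta),\qquad\forall\,\theta\neq\theta_1 .$$ Correspondingly, the error exponent $\Phi(\pi)=\min_{\theta\ne\theta_1}\Phi(\pi,\theta)$ satisfies $$\min_{\theta\neq\theta_1}\min_{k\in\mathcal N}\Phi_k^{\mathsf{nc}}(\theta)\le\Phi(\pi)\le\min_{\theta\neq\theta_1}\sum_{k=1}^N\Phi_k^{\mathsf{nc}}(\theta).$$
   Context: There are $N$ agents $\mathcal N=\{1,\dots,N\}$ and a hypothesis set $\Theta=\{\theta_1,\dots,\theta_H\}$ with true state $\theta_1$. At each time $i=1,2,\dots$ agent $k$ receives a signal $\xi_{k,i}\in\mathcal X_k$ with distribution $f_k$ (a pdf or pmf); the signals are independent over agents and over time. Agent $k$ has likelihood models $L_k(\cdot|\theta)$, $\theta\in\Theta$ (pdfs or pmfs, of the same type as $f_k$), with the same support $\mathcal X_k$ as $f_k$; $f_k$ need not equal any $L_k(\cdot|\theta)$. Put $x_{k,i}(\theta)=\log\frac{L_k(\xi_{k,i}|\theta_1)}{L_k(\xi_{k,i}|\theta)}$, $d_k(\theta)=\mathbb E[x_{k,i}(\theta)]=D_{\mathrm{KL}}(f_k\|L_k(\cdot|\theta))-D_{\mathrm{KL}}(f_k\|L_k(\cdot|\theta_1))$, and $\Lambda_k(t;\theta)=\log\mathbb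 E[e^{tx_{k,i}(\theta)}]$, with expectations with respect to $f_k$. Standing assumptions: all $D_{\mathrm{KL}}(f_k\|L_k(\cdot|\theta))$ are finite; $\Lambda_k(t;\theta)<\infty$ for all $t\in\mathbb R$, $k\in\mathcal N$, $\theta\ne\theta_1$; identifiability: with $\Theta_k^\star=\arg\min_{\theta\in\Theta}D_{\mathrm{KL}}(f_k\|L_k(\cdot|\theta))$ and $\mathcal N_A=\{k:\theta_1\in\Theta_k^\star\}$, one has $\bigcap_{k\in\mathcal N_A}\Theta_k^\star=\{\theta_1\}$. The set of feasible Perron eigenvectors is $$\Pi=\Big\{\pi\in\mathbb R^N:\ \textstyle\sum_k\pi_k=1,\ \pi_k>0\ \forall k,\ \ \mathsf m_{\mathsf{ave}}(\pi,\theta):=\sum_{k=1}^N\pi_kd_k(\theta)>0\ \ \forall\theta\neq\theta_1\Big\}.$$ For $\pi\in\Pi$ and $\theta\ne\theta_1$ put $\Lambda_{\mathsf{ave}}(t;\pi,\theta)=\sum_{k=1}^N\Lambda_k(\pi_kt;\theta)$, $\phi(t;\pi,\theta)=\int_0^t\frac{\Lambda_{\mathsf{ave}}(\tau;\pi,\theta)}{\tau}d\tau$ (integrand extended by continuity at $0$) and $\Phi(\pi,\theta)=-\inf_{t\in\mathbb R}\phi(t;\pi,\theta)$. Non-cooperative quantities: for step-size $\delta\in(0,1)$ let $\widetilde\lambda^{\mathsf{nc}}_{k,\infty}(\theta)=\delta\sum_{m=0}^\infty(1-\delta)^mx_{k,m+1}(\theta)$ and $p_k^{\mathsf{nc}}(\theta)=\mathbb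 P[\widetilde\lambda^{\mathsf{nc}}_{k,\infty}(\theta)\le0]$. The non-cooperative $\theta$-related error exponent of agent $k$ is $\Phi_k^{\mathsf{nc}}(\theta)=-\lim_{\delta\to0}\delta\ln p_k^{\mathsf{nc}}(\theta)$. (With $\phi_k^{\mathsf{nc}}(t;\theta)=\int_0^t\frac{\Lambda_k(\tau;\theta)}{\tau}d\tau$, one has $\Phi_k^{\mathsf{nc}}(\theta)=-\inf_{t\in\mathbb R}\phi_k^{\mathsf{nc}}(t;\theta)$ if $d_k(\theta)>0$ and $\Phi_k^{\mathsf{nc}}(\theta)=0$ if $d_k(\theta)\le0$ or $\Lambda_k(\cdot;\theta)\equiv0$.) *)

(* Defs.v *)
From HB Require Import structures.
From mathcomp Require Export all_boot all_order all_algebra.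
From mathcomp Require Export all_classical all_reals all_analysis.
Export Order.TTheory GRing.Theory Num.Theory.
Export numFieldNormedType.Exports.

Set Implicit Arguments.
Unset Strict Implicit.
Unset Printing Implicit Defensive.

Local Open Scope classical_set_scope.
Local Open Scope ring_scope.
Local Open Scope ereal_scope.

Definition mutually_independent (R : realType) (dO : measure_display)
    (Omega : measurableType dO) (P : probability Omega R) (I : choiceType)
    (d : I -> measure_display) (X : forall i, measurableType (d i))
    (Y : forall i, Omega -> X i) : Prop :=
  forall (J : seq I) (A : forall i, set (X i)), uniq J ->
    (forall i, measurable (A i)) ->
    P (\bigcap_(i in [set` J]) (Y i @^-1` A i)) =
    \prod_(i <- J) P (Y i @^-1` A i).

(* Densities are taken with respect to a reference measure mu: pdfs and pmfs
   are the cases of the Lebesgue and of the counting measure. *)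
Section density.
Context (R : realType) (d : measure_display) (X : measurableType d).
Variable mu : {sigma_finite_measure set X -> \bar R}.

Definition is_density (supp : set X) (g : X -> R) : Prop :=
  [/\ measurable_fun setT g, (forall x, (0 <= g x)%R),
      \int[mu]_x (g x)%:E = 1 & [set x | (0 < g x)%R] = supp].

Definition expect (f g : X -> R) : \bar R := \int[mu]_x (f x * g x)%:E.

Definition KL (f g : X -> R) : \bar R :=
  expect f (fun x => ln (f x / g x))%R.

End density.

Section exponents.
Context (R : realType).

(* s |-> g s / s, extended by continuity at 0 *)
Definition quot0 (g : R -> R) (s : R) : R :=
  if s == 0%R then lim ((g u / u)%R @[u --> 0^'%R]) else (g s / s)%R.

(* The integral of g from 0 to t, for t of either sign. *)
Definition integral0 (g : R -> R) (t : R) : R :=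
  if (0 <= t)%R then (\int[lebesgue_measure]_(s in `[0%R, t]) g s)%R
  else (- \int[lebesgue_measure]_(s in `[t, 0%R]) g s)%R.

End exponents.

Section social_learning.
Context (R : realType) (N : nat) (Theta : finType) (theta1 : Theta).
Context (d : 'I_N -> measure_display) (X : forall k, measurableType (d k)).
Variable mu : forall k, {sigma_finite_measure set (X k) -> \bar R}.
Variables (f : forall k, X k -> R) (L : forall k, Theta -> X k -> R).

(* The log-likelihood ratio: x_{k,i}(theta) is llr theta (xi_{k,i}). It takes
   the value 0 off the common support, which has probability 0. *)
Definition llr (k : 'I_N) (theta : Theta) (x : X k) : R :=
  ln (L theta1 x / L theta x).

Definition drift (k : 'I_N) (theta : Theta) : R :=
  fine (expect (mu k) (@f k) (llr theta)).

Definition Lambda (k : 'I_N) (theta : Theta) (t : R) : \bar R :=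
  lne (expect (mu k) (@f k) (fun x => expR (t * llr theta x))%R).

Definition Theta_star (k : 'I_N) : set Theta :=
  [set theta | forall theta',
    KL (mu k) (@f k) (@L k theta) <= KL (mu k) (@f k) (@L k theta')].

Definition N_A : set 'I_N := [set k | theta1 \in Theta_star k].

Definition identifiable : Prop :=
  \bigcap_(k in N_A) Theta_star k = [set theta1].

Definition m_ave (w : 'rV[R]_N) (theta : Theta) : R :=
  (\sum_(k < N) w ord0 k * drift k theta)%R.

(* Perron eigenvectors are row vectors, with entries w ord0 k. *)
Definition Perron : set 'rV[R]_N :=
  [set w : 'rV[R]_N | [/\ (\sum_(k < N) w ord0 k = 1)%R,
               (forall k, (0 < w ord0 k)%R) &
               (forall theta, theta != theta1 -> (0 < m_ave w theta)%R)]].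

Definition Lambda_ave (w : 'rV[R]_N) (theta : Theta) (t : R) : \bar R :=
  \sum_(k < N) Lambda k theta (w ord0 k * t)%R.

Definition phi (w : 'rV[R]_N) (theta : Theta) (t : R) : R :=
  integral0 (quot0 (fun s => fine (Lambda_ave w theta s))) t.

Definition Phi (w : 'rV[R]_N) (theta : Theta) : \bar R :=
  - ereal_inf (range (fun t => (phi w theta t)%:E)).

(* A minimum over the empty set is +oo (this is the case Theta = {theta1}). *)
Definition Phi_min (w : 'rV[R]_N) : \bar R :=
  \big[mine/+oo]_(theta | theta != theta1) Phi w theta.

Section noncooperative.
Context (dO : measure_display) (Omega : measurableType dO).
Variable P : probability Omega R.
(* xi k m is the signal received by agent k at time m.+1. *)
Variable xi : forall k, nat -> {RV P >-> X k}.

(* Under the assumptions of the model the series converges almost surely, so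
   the value of the total operator lim elsewhere is irrelevant. *)
Definition lambda_nc (delta : R) (k : 'I_N) (theta : Theta) (w : Omega) : R :=
  (delta * \big[+%R/0]_(0 <= m <oo)
             ((1 - delta) ^+ m * llr theta (xi k m w)))%R.

Definition p_nc (delta : R) (k : 'I_N) (theta : Theta) : \bar R :=
  P [set w | (lambda_nc delta k theta w <= 0)%R].

Definition Phi_nc (k : 'I_N) (theta : Theta) : \bar R :=
  - lim ((delta%:E * lne (p_nc delta k theta)) @[delta --> 0^'+%R]).

End noncooperative.

End social_learning.

(* Main.v *)
Require Import Defs.
From mathcomp Require Import ring lra measurable_realfun.

(** Each phi_k(t), the integral of Lambda_k(tau)/tau, is convex with the
    nondecreasing subgradient Lambda_k(tau)/tau.  Evaluated along the geometric
    grid t (1 - delta)^m, the cumulants of the discounted sum are Riemann sums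
    of this slope, so that delta ln E exp(t lambda / delta) tends to phi_k(t).
    A Chernoff bound and an exponential-moment form of Cramer's lower bound then
    give Phi_k^nc = - min of phi_k over t <= 0, attained at some t_k <= 0.

    Since phi(t; pi) = sum_k phi_k(pi_k t), the upper bound on Phi is
    termwise minimization (for t > 0, phi >= m_ave t >= 0), and the lower bound
    is obtained at t = max_k t_k / pi_k, where the terms of all agents but the
    maximizing one are nonpositive. *)

Set Implicit Arguments.
Unset Strict Implicit.
Unset Printing Implicit Defensive.

Local Open Scope classical_set_scope.
Local Open Scope ring_scope.

(** [Phi_nc] is a genuine limit as delta tends to 0, so a large deviation result for the infinite
    discounted series has to be proved for each agent. Neither differentiability nor continuity of
    the cumulant functions is used: monotone slopes and the subgradient inequality replace them,
    which is why minimizers are infima of sublevel sets and are approached from one side. The event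
    lambda <= 0 calls for exponents t <= 0 only, so the sign of the drift is never distinguished: a
    negative drift makes the cumulant function positive left of 0, and the minimizer is then 0
    itself. The real distinction is whether Lambda_k is positive somewhere on t < 0. If not, E
    exp(tx) <= 1 for all t < 0 forces x >= 0 almost surely, and two densities of integral 1 that are
    ordered almost everywhere coincide; then x = 0 almost surely, p = 1 and the exponent is 0. *)

Definition subgradient (R : realType) (phi g : R -> R) : Prop :=
  forall a b, phi b + g b * (a - b) <= phi a.

(** * Primitives of monotone functions and their subgradients *)

Section subgradient.
Context (R : realType).
Implicit Types (g phi : R -> R).
Local Notation leb := (@lebesgue_measure R).

Lemma integrable_nondecreasing_itv g a b : {homo g : x y / x <= y} ->
  leb.-integrable `[a, b] (EFin \o g).
Proof.
move=> gmono; apply: measurable_bounded_integrable => //.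
- rewrite /= lebesgue_measure_itv/= lte_fin.
  by case: ifP => // _; rewrite -EFinB ltry.
- exact: nondecreasing_measurable.
- exists (`|g a| + `|g b|); split; first exact: num_real.
  move=> M hM x /=.
  rewrite in_itv/= => /andP[ax xb].
  apply: le_trans (ltW hM).
  have := gmono _ _ ax; have := gmono _ _ xb.
  move=> h1 h2; rewrite ler_norml.
  have := ler_norm (g b); have := ler_norm (- g a); rewrite normrN => h3 h4.
  have := normr_ge0 (g b); have := normr_ge0 (g a) => h5 h6.
  by apply/andP; split; lra.
Qed.

Lemma Rintegral_itv_cst a b (c : R) : a <= b ->
  (\int[leb]_(x in `[a, b]) c = c * (b - a))%R.
Proof.
move=> ab; rewrite Rintegral_cst//= lebesgue_measure_itv/= lte_fin.
case: ltP => [_|ba]; first by rewrite -EFinB.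
have -> : b = a by apply/eqP; rewrite eq_le ab ba.
by rewrite subrr mulr0.
Qed.

Lemma Rintegral_nondecreasing_bounds g a b : {homo g : x y / x <= y} -> a <= b ->
  g a * (b - a) <= (\int[leb]_(x in `[a, b]) g x)%R <= g b * (b - a).
Proof.
move=> gmono ab; rewrite -!Rintegral_itv_cst//.
have ig := integrable_nondecreasing_itv a b gmono.
have ic c : leb.-integrable `[a, b] (EFin \o cst c).
  by apply: integrable_nondecreasing_itv => x y _.
apply/andP; split; apply: le_Rintegral; try exact: ic; rewrite //= => x;
  rewrite /= in_itv/= => /andP[ax xb]; exact: gmono.
Qed.

Lemma integral0B g a b : {homo g : x y / x <= y} -> a <= b ->
  (integral0 g b - integral0 g a = \int[leb]_(x in `[a, b]) g x)%R.
Proof.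
move=> gmono.
have split3 x y z : x <= y -> y <= z -> (\int[leb]_(t in `[x, z]) g t =
    \int[leb]_(t in `[x, y]) g t + \int[leb]_(t in `[y, z]) g t)%R.
  move=> xy yz.
  have := @Rintegral_itvB R g (BLeft x) (BRight z) y
    (integrable_nondecreasing_itv x z gmono).
  rewrite !bnd_simp => /(_ xy yz) E.
  rewrite -(subrK (\int[leb]_(t in `[x, y]) g t)%R (\int[leb]_(t in `[x, z]) g t)%R) E.
  rewrite    Rintegral_itv_obnd_cbnd 1?addrC//.
  apply: integrableS (integrable_nondecreasing_itv y z gmono) => //.
  by apply: subset_itvr; rewrite bnd_simp.
move=> ab; rewrite /integral0.
have [b0|b0] := leP 0 b; have [a0|a0] := leP 0 a; rewrite ?opprK.
- by rewrite (split3 0 a b)//; lra.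
- by rewrite (split3 a 0 b)//; lra.
- by have := le_trans a0 ab; rewrite leNgt b0.
- by rewrite (split3 a b 0)//; lra.
Qed.

Lemma integral00 g : integral0 g 0 = 0.
Proof. by rewrite /integral0 lexx set_itv1 Rintegral_set1. Qed.

Lemma subgradient_integral0 g : {homo g : x y / x <= y} ->
  subgradient (integral0 g) g.
Proof.
move=> gmono a b; have [ab|ba] := leP a b.
- have /andP[_] := Rintegral_nondecreasing_bounds gmono ab.
  by rewrite -integral0B//; lra.
- have /andP[+ _] := Rintegral_nondecreasing_bounds gmono (ltW ba).
  by rewrite -integral0B ?(ltW ba)//; lra.
Qed.

(** The point 0 is Lebesgue-null. Hence the value of [quot0] at 0, which is a [lim], never has to be
    computed. *)
Lemma eq_integral0 g1 g2 : {homo g2 : x y / x <= y} ->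
  (forall x, x != 0 -> g1 x = g2 x) -> integral0 g1 =1 integral0 g2.
Proof.
move=> gmono eg t; rewrite /integral0; case: leP => t0.
  have e12 : {in `]0, t]%classic, g1 =1 g2}.
    by move=> x /set_mem/=; rewrite in_itv/= => /andP[x0 _]; rewrite eg// gt_eqF.
  have i2 : leb.-integrable `]0, t] (EFin \o g2).
    apply: integrableS (integrable_nondecreasing_itv 0 t gmono) => //.
    by apply: subset_itvr; rewrite bnd_simp.
  have i1 : leb.-integrable `]0, t] (EFin \o g1).
    by apply: eq_integrable i2 => // x /e12 /= ->.
  by rewrite -!(@Rintegral_itv_obnd_cbnd R 0)//; exact: eq_Rintegral.
have e12 : {in `[t, 0[%classic, g1 =1 g2}.
  by move=> x /set_mem/=; rewrite in_itv/= => /andP[_ x0]; rewrite eg// lt_eqF.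
have i2 : leb.-integrable `[t, 0[ (EFin \o g2).
  apply: integrableS (integrable_nondecreasing_itv t 0 gmono) => //.
  by apply: subset_itvl; rewrite bnd_simp.
have i1 : leb.-integrable `[t, 0[ (EFin \o g1).
  by apply: eq_integrable i2 => // x /e12 /= ->.
by rewrite -!(@Rintegral_itv_bndo_bndc R _ 0)//; congr (- _); exact: eq_Rintegral.
Qed.

(* On a cell of length h, the increments of two functions with the same
   subgradient g differ by at most h times the increment of g. *)
Lemma subgradient_unique phi1 phi2 g : subgradient phi1 g ->
  subgradient phi2 g -> phi1 0 = phi2 0 -> phi1 =1 phi2.
Proof.
move=> s1 s2 e0 t.
pose D x := phi1 x - phi2 x.
have stepD a b : `|D a - D b| <= (g a - g b) * (a - b).
  have := s1 a b; have := s1 b a; have := s2 a b; have := s2 b a.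
  by rewrite /D ler_norml => *; apply/andP; split; lra.
pose C := (g t - g 0) * t.
have C0 : 0 <= C by have := le_trans (normr_ge0 _) (stepD t 0); rewrite subr0.
(* Over n.+1 cells of length h the increments of g telescope, so the total discrepancy is at most (g
   t - g 0) h = C / n.+1, which tends to 0. *)
have bound n : `|D t| * n.+1%:R <= C.
  pose h := t / n.+1%:R.
  have ht : h * n.+1%:R = t by rewrite divfK// pnatr_eq0.
  have ind m : `|D (h * m%:R)| <= (g (h * m%:R) - g 0) * h.
    elim: m => [|m IH]; first by rewrite mulr0 subrr mul0r /D e0 subrr normr0.
    have := stepD (h * m.+1%:R) (h * m%:R).
    rewrite (_ : h * m.+1%:R - h * m%:R = h); last by rewrite -natr1; ring.
    move=> st; rewrite -(subrK (D (h * m%:R)) (D (h * m.+1%:R))).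
    by apply: le_trans (ler_normD _ _) _; lra.
  have := ind n.+1; rewrite ht => H.
  have -> : C = (g t - g 0) * h * n.+1%:R by rewrite /C -mulrA ht.
  by rewrite ler_wpM2r.
apply/eqP; rewrite -subr_eq0 -normr_eq0 -/(D t); apply/eqP.
have [//|Dpos] : `|D t| = 0 \/ 0 < `|D t|.
  by have := normr_ge0 (D t); rewrite le_eqVlt => /orP[/eqP<-|]; [left|right].
have [n Hn] : exists n : nat, C / `|D t| < n%:R.
  by exists (Num.truncn (C / `|D t|)).+1; rewrite truncnS_gt.
have := bound n; rewrite leNgt => /negP[].
rewrite mulrC -ltr_pdivrMr//; apply: lt_trans Hn _.
by rewrite ltr_nat.
Qed.

End subgradient.

(** * Chord slopes of cumulant functions, and two limiting devices *)

(** The chord from the origin. Its value at 0 is a parameter, later the drift: a subgradient at 0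
    suffices there, and no derivative has to be taken. *)
Definition slope (R : realType) (g : R -> R) (c s : R) : R :=
  if s == 0 then c else g s / s.

(** For two points of the same sign, scaling the outer one down to the inner one compares the
    chords; for opposite signs, c separates the two slopes. *)
Lemma slope_nondecreasing (R : realType) (g : R -> R) (c : R) :
  (forall p s, 0 <= p <= 1 -> g (p * s) <= p * g s) ->
  (forall s, c * s <= g s) ->
  {homo slope g c : x y / x <= y}.
Proof.
move=> gscale gsup x y; rewrite le_eqVlt => /predU1P[->//|xy].
rewrite /slope; case: eqVneq => [x0|x0]; case: eqVneq => [y0|y0].
- by [].
- by rewrite ler_pdivlMr//; rewrite -x0.
- by rewrite ler_ndivrMr//; rewrite -y0.
have [xpos|xneg] := ltP 0 x.
  have ypos := lt_trans xpos xy.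
  have := gscale (x / y) y; rewrite divfK//.
  have -> : 0 <= x / y <= 1.
    by rewrite divr_ge0 ?(ltW xpos) ?(ltW ypos)//= ler_pdivrMr// mul1r ltW.
  move=> /(_ isT); rewrite ler_pdivrMr// => h; apply: le_trans h _.
  suff -> : x / y * g y = g y / y * x by [].
  by field.
have {xneg} xneg : x < 0 by rewrite lt_neqAle x0.
have [ypos|yneg] := ltP 0 y.
  apply: (@le_trans _ _ c); first by rewrite ler_ndivrMr.
  by rewrite ler_pdivlMr.
have {yneg} yneg : y < 0 by rewrite lt_neqAle y0.
have := gscale (y / x) x; rewrite divfK//.
have -> : 0 <= y / x <= 1.
  by rewrite -(mulrNN y) -invrN divr_ge0 ?oppr_ge0 ?(ltW xneg) ?(ltW yneg)//=
    ler_pdivrMr ?oppr_gt0// mul1r lerN2 ltW.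
move=> /(_ isT); rewrite ler_ndivlMr// => h; apply: le_trans h _.
suff -> : y / x * g x = g x / x * y by [].
by field.
Qed.

(** Lets e tend to 0 in a bound with a linear error; [minimizerP] uses it to reach the minimizer
    from one side. *)
Lemma ler_approach (R : realType) (a b K : R) :
  (forall e, 0 < e -> e < 1 -> a - K * e <= b) ->
  a <= b.
Proof.
move=> h; apply/ler_addgt0Pr => e e0.
have K1 : 0 < `|K| + 1 by have := normr_ge0 K; lra.
pose e' := Num.min (1 / 2) (e / (`|K| + 1)).
have e'0 : 0 < e' by rewrite /e' lt_min divr_gt0//= divr_gt0.
have e'1 : e' < 1 by rewrite /e' gt_min; apply/orP; left; lra.
have : K * e' <= e.
  apply: (@le_trans _ _ ((`|K| + 1) * e')).
    by rewrite ler_wpM2r ?(ltW e'0)//; have := ler_norm K; lra.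
  by rewrite mulrC -ler_pdivlMr// /e' ge_min lexx orbT.
by have := h _ e'0 e'1; lra.
Qed.

(** Since x <= exp x, the exponential is at most delta / c. *)
Lemma near_expR_le (R : realType) (C c e : R) : 0 < c -> 0 < e ->
  \forall delta \near 0^'+, C * expR (- c / delta) <= e.
Proof.
move=> c0 e0; have C1 : 0 < `|C| + 1 by have := normr_ge0 C; lra.
have dpos : 0 < e * c / (`|C| + 1) by rewrite divr_gt0// mulr_gt0.
near=> delta.
have d0 : 0 < delta by near: delta; exact: nbhs_right_gt.
have dlt : delta < e * c / (`|C| + 1) by near: delta; exact: nbhs_right_lt.
rewrite mulNr expRN.
have ex : c / delta <= expR (c / delta).
  by apply: le_trans (expR_ge1Dx _); rewrite lerDr.
have cd0 : 0 < c / delta by rewrite divr_gt0.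
apply: (@le_trans _ _ ((`|C| + 1) * (c / delta)^-1)).
  apply: (@le_trans _ _ ((`|C| + 1) * (expR (c / delta))^-1)).
    by rewrite ler_wpM2r ?invr_ge0 ?expR_ge0//; have := ler_norm C; lra.
  by rewrite ler_wpM2l ?(ltW C1)// lef_pV2// posrE ?expR_gt0.
rewrite invf_div mulrA ler_pdivrMr// mulrC -ler_pdivlMr//; exact: ltW.
Unshelve. all: by end_near. Qed.

(** * From exponential moment bounds to the exponential rate *)

Section rate.
Context (R : realType) (M phi : R -> R) (c t0 : R).
Local Notation La := (fun t => ln (M t)).
Local Notation g := (slope La c).
Context (M_gt0 : forall t, 0 < M t) (M0 : M 0 = 1)
  (M_convex : forall p a b, 0 <= p <= 1 ->
     M (p * a + (1 - p) * b) <= p * M a + (1 - p) * M b)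
  (La_scale : forall p s, 0 <= p <= 1 -> La (p * s) <= p * La s)
  (La_drift : forall s, c * s <= La s)
  (phi_sub : subgradient phi g) (phi0 : phi 0 = 0)
  (t0_lt0 : t0 < 0) (La_t0 : 0 < La t0).

(** Its infimum plays the part of the negative zero of ln M. Left of the infimum the slope is
    negative, right of it (up to 0) nonnegative, and this needs no continuity. *)
Definition sublevel : set R := [set t | t <= 0 /\ La t <= 0].

Definition minimizer : R := inf sublevel.
Local Notation ts := minimizer.

Lemma La_gt0_left t : t <= t0 -> 0 < La t.
Proof.
move=> tt0; have t_lt0 := le_lt_trans tt0 t0_lt0.
have := @La_scale (t0 / t) t; rewrite divfK ?lt_eqF//.
have p01 : 0 <= t0 / t <= 1.
  by rewrite -(mulrNN t0) -invrN divr_ge0 ?oppr_ge0 ?(ltW t_lt0) ?(ltW t0_lt0)//=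
    ler_pdivrMr ?oppr_gt0// mul1r lerN2.
rewrite p01 => /(_ isT) h; have : 0 < t0 / t * La t := lt_le_trans La_t0 h.
by case/andP: p01 => p0 _; rewrite pmulr_rgt0// nmulr_rgt0 ?invr_lt0.
Qed.

Lemma sublevel0 : sublevel 0.
Proof. by split => //=; rewrite M0 ln1. Qed.

Lemma has_inf_sublevel : has_inf sublevel.
Proof.
split; first by exists 0; exact: sublevel0.
exists t0 => t [_]; rewrite leNgt => /negP La_le.
by rewrite leNgt; apply/negP => tt0; apply: La_le; apply: La_gt0_left; exact: ltW.
Qed.

Lemma minimizer_le0 : ts <= 0.
Proof. by apply: ge_inf; [exact: has_inf_sublevel.2|exact: sublevel0]. Qed.

(** The margin 1 keeps a segment of positive length to the left of the minimizer, on which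
    [La_le_minimizer] interpolates. *)
Lemma minimizer_gt : t0 - 1 < ts.
Proof.
apply: (@lt_le_trans _ _ t0); first by lra.
apply: lb_le_inf; first by exists 0; exact: sublevel0.
move=> t [_]; rewrite leNgt => /negP La_le.
by rewrite leNgt; apply/negP => tt0; apply: La_le; apply: La_gt0_left; exact: ltW.
Qed.

Lemma La_gt0_minimizer t : t < ts -> 0 < La t.
Proof.
move=> tts; rewrite ltNge; apply/negP => La_le.
have : ts <= t; last by rewrite leNgt tts.
apply: ge_inf; first exact: has_inf_sublevel.2.
by split => //=; apply: le_trans minimizer_le0; exact: ltW.
Qed.

Lemma slope_lt0_minimizer t : t < ts -> g t < 0.
Proof.
move=> tts; have tlt0 := lt_le_trans tts minimizer_le0.
by rewrite /slope lt_eqF// pmulr_rlt0 ?invr_lt0// La_gt0_minimizer.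
Qed.

(** Some u < s lies in the sublevel set; the slope at u is a quotient of two nonpositive numbers,
    and monotonicity carries its sign to s. *)
Lemma phi_nondecreasing_minimizer s t : ts < s -> s <= t -> t <= 0 -> phi s <= phi t.
Proof.
move=> tss st t_le0; apply: le_trans (phi_sub t s).
rewrite lerDl; have [->|snt] := eqVneq s t; first by rewrite subrr mulr0.
have s_lt0 : s < 0 by apply: lt_le_trans t_le0; rewrite lt_neqAle snt.
rewrite mulr_ge0 ?subr_ge0//.
have [u [ule0 Lau] us] := inf_lt has_inf_sublevel.1 tss.
have u_lt0 := lt_trans us s_lt0.
apply: (@le_trans _ _ (g u)); last exact: slope_nondecreasing (ltW us).
by rewrite /slope lt_eqF// -mulrNN -invrN mulr_ge0 ?oppr_ge0// invr_ge0 oppr_ge0 ltW.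
Qed.

(** The sign of the slope at the minimizer itself is not known. So t is compared with a point s
    strictly on its own side, and s then moves to the minimizer, at a cost linear in the distance by
    the subgradient inequality. *)
Lemma minimizerP t : t <= 0 -> phi ts <= phi t.
Proof.
move=> t_le0.
have [tts|tst|->//] := ltgtP t ts.
  have near : forall s, t <= s -> s < ts -> phi s <= phi t.
    move=> s ts' ss; apply: le_trans (phi_sub t s).
    by rewrite lerDl mulr_le0 ?subr_le0// ltW// slope_lt0_minimizer.
  apply: (@ler_approach _ _ _ (`|g ts| * (ts - t))) => e e0 e1.
  pose s := ts - e * (ts - t).
  have st : s < ts by rewrite /s; have : 0 < e * (ts - t); [rewrite mulr_gt0// subr_gt0|lra].
  have s1 : t <= s by rewrite /s; nra.
  apply: le_trans (near s s1 st); apply: le_trans (phi_sub s ts).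
  have -> : s - ts = - (e * (ts - t)) by rewrite /s; ring.
  by have := ler_norm (g ts); have : 0 < e * (ts - t); [rewrite mulr_gt0// subr_gt0|nra].
apply: (@ler_approach _ _ _ (`|g ts| * (t - ts))) => e e0 e1.
pose s := ts + e * (t - ts).
have st : ts < s by rewrite /s; have : 0 < e * (t - ts); [rewrite mulr_gt0// subr_gt0|lra].
have s1 : s <= t by rewrite /s; nra.
apply: le_trans (phi_nondecreasing_minimizer st s1 t_le0); apply: le_trans (phi_sub s ts).
have -> : s - ts = e * (t - ts) by rewrite /s; ring.
by have := ler_norm (- g ts); rewrite normrN;
  have : 0 < e * (t - ts); [rewrite mulr_gt0// subr_gt0|nra].
Qed.

Lemma phi_le0_minimizer t : ts <= t -> t <= 0 -> phi t <= 0.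
Proof.
rewrite le_eqVlt => /predU1P[<- _|tst t_le0].
  by rewrite -phi0; exact: minimizerP.
by rewrite -phi0; exact: phi_nondecreasing_minimizer.
Qed.

(** A one-sided Lipschitz bound at the minimizer, from convexity of M: the point lies between t0 - 1
    and a sublevel point u < ts + h with M u <= 1, at distance less than 4 h from u, and ln x <= x -
    1. The offset 3 h is that of the leftmost point in [rate_lower]. *)
Lemma La_le_minimizer : exists2 C : R, 0 <= C &
  forall h, 0 < h -> 3 * h < ts - (t0 - 1) -> La (ts - 3 * h) <= C * h.
Proof.
pose t1 := t0 - 1; pose l := ts - t1.
have l0 : 0 < l by rewrite subr_gt0 minimizer_gt.
have M1 : 1 < M t1.
  have : 0 < La t1 by apply: La_gt0_left; rewrite /t1; lra.
  by apply: contraTT; rewrite -!leNgt => ?; rewrite ln_le0.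
exists (4 * (M t1 - 1) / l); first by rewrite divr_ge0 ?mulr_ge0 ?(ltW l0)//; lra.
move=> h h0; rewrite -/t1 -/l => hl.
have [u [ule0 Lau] uts] := inf_adherent h0 has_inf_sublevel.
have Mu : M u <= 1.
  by rewrite -ler_ln ?posrE// ln1.
have tsu : ts <= u by apply: ge_inf; [exact: has_inf_sublevel.2|].
rewrite -/ts in uts.
pose t := ts - 3 * h; pose p := (u - t) / (u - t1).
have ut1 : 0 < u - t1 by rewrite /l in l0; lra.
have p0 : 0 <= p by rewrite divr_ge0 ?(ltW ut1)// /t; lra.
have p1 : p <= 1 by rewrite ler_pdivrMr// mul1r /t /l in hl *; lra.
have pt : p * t1 + (1 - p) * u = t by rewrite /p; field; rewrite gt_eqF.
have := @M_convex p t1 u; rewrite pt p0 p1 => /(_ isT) Mt.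
have pb : p * l <= 4 * h.
  apply: (@le_trans _ _ (p * (u - t1))); first by rewrite ler_wpM2l// /l; lra.
  by rewrite divfK ?gt_eqF// /t; lra.
apply: (@le_trans _ _ (M t - 1)).
  by rewrite -ler_expR lnK ?posrE//; have := expR_ge1Dx (M t - 1); rewrite addrC subrK.
have : (1 - p) * M u <= (1 - p) * 1 by rewrite ler_wpM2l//; lra.
move=> h2; apply: (@le_trans _ _ (p * (M t1 - 1))); first by lra.
rewrite [leRHS]mulrAC ler_pdivlMr//.
have : 0 <= (M t1 - 1) * (4 * h - p * l) by rewrite mulr_ge0//; lra.
lra.
Qed.

Context (p : R -> R) (Z : R -> R -> R)
  (Z_ge : forall delta t, 0 < delta < 1 -> expR (phi t / delta) <= Z delta t)
  (Z_le : forall delta t, 0 < delta < 1 ->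
     Z delta t <= expR (((1 - delta) * phi t + delta * La t) / delta))
  (p_le : forall delta t, 0 < delta < 1 -> t <= 0 -> p delta <= Z delta t)
  (p_ge : forall delta t h a, 0 < delta < 1 -> t <= 0 -> 0 <= h -> 0 <= a ->
     Z delta t <= expR (- t * a / delta) * p delta + Z delta (t + h) +
                  expR (- h * a / delta) * Z delta (t - h)).

Lemma rate_upper e : 0 < e ->
  \forall delta \near 0^'+, p delta <= expR ((phi ts + e) / delta).
Proof.
move=> e0; pose K := `|La ts - phi ts| + 1.
have K0 : 0 < K by rewrite /K ltr_wpDl.
have eK : 0 < e / K by rewrite divr_gt0.
near=> delta.
have d0 : 0 < delta by near: delta; exact: nbhs_right_gt.
have d1 : delta < 1 by near: delta; exact: nbhs_right_lt.
have dK : delta < e / K by near: delta; exact: nbhs_right_lt.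
have d01 : 0 < delta < 1 by rewrite d0 d1.
apply: le_trans (p_le d01 minimizer_le0) _; apply: le_trans (Z_le ts d01) _.
rewrite ler_expR ler_wpM2r ?invr_ge0 ?(ltW d0)//.
have : delta * (La ts - phi ts) <= delta * K.
  by rewrite ler_wpM2l ?(ltW d0)// /K (le_trans (ler_norm _))// lerDl.
have : delta * K < e by rewrite -ltr_pdivlMr.
lra.
Unshelve. all: by end_near. Qed.

(* Off the event T <= 0 and below the level -a/delta, exp(tT) is dominated by
   the moment generating functions at t + h and t - h, which are exponentially
   smaller than the one at t; this is the change of measure of Cramer's lower
   bound without the tilted measure. *)
Lemma rate_lower e : 0 < e ->
  \forall delta \near 0^'+, expR ((phi ts - e) / delta) <= p delta.
Proof.
move=> e0; have [C C0 LaC] := La_le_minimizer.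
(* K h bounds the loss - t a below: C h comes from ln M at s, and (|ts| + 2) h from - t h, using h
   <= 1. *)
pose K := C + `|ts| + 3.
have K0 : 0 < K by rewrite /K; have := normr_ge0 ts => /=; lra.
pose l := ts - (t0 - 1); have l0 : 0 < l by rewrite subr_gt0 minimizer_gt.
pose h := Num.min (Num.min 1 (l / 6)) (e / 2 / K).
have h0 : 0 < h.
  by rewrite /h !lt_min; apply/andP; split; [apply/andP; split|]; rewrite ?divr_gt0.
have h1 : h <= 1 by rewrite /h !ge_min lexx.
have hl : h <= l / 6 by rewrite /h !ge_min lexx !orbT.
have hK : h * K <= e / 2 by rewrite -ler_pdivlMr// /h ge_min lexx orbT.
have h3l : 3 * h < l by lra.
(* The tilt t has the competitors u = t + h and s = t - h. All three lie left of the minimizer,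
   where the slope is negative, so phi strictly decreases from t to u. *)
pose s := ts - 3 * h; pose t := ts - 2 * h; pose u := ts - h.
have ts0 := minimizer_le0.
have s0 : s < 0 by rewrite /s; lra.
have gs : g s < 0 by apply: slope_lt0_minimizer; rewrite /s; lra.
have gu : g u < 0 by apply: slope_lt0_minimizer; rewrite /u; lra.
(* The subgradient at s gives phi t - phi s >= h g(s), so this cut-off makes phi t - phi s + h a at
   least h * h. *)
pose a := h - g s; have a0 : 0 < a by rewrite /a; lra.
have ta : - (e / 2) <= t * a.
  have Las : La s <= C * h := LaC h h0 h3l.
  have gsE : g s * s = La s by rewrite /slope lt_eqF// divfK ?lt_eqF.
  have tgs : t * g s <= s * g s.
    by rewrite ler_nM2r// /s /t; lra.
  have th : - t * h <= (`|ts| + 2) * h.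
    by rewrite ler_wpM2r ?(ltW h0)// /t; have := ler_norm (- ts); rewrite normrN; lra.
  rewrite (mulrC s) gsE /= in tgs; rewrite /= in Las.
  by move: hK; rewrite /K /a; lra.
have phit : phi ts <= phi t by apply: minimizerP; rewrite /t; lra.
have c1 : 0 < phi t - phi u.
  have := phi_sub t u; have -> : t - u = - h by rewrite /t /u; ring.
  have : g u * - h > 0 by rewrite nmulr_rgt0// oppr_lt0.
  lra.
have c2 : 0 < phi t - phi s + h * a.
  have := phi_sub t s; have -> : t - s = h by rewrite /t /s; ring.
  have : 0 < h * h by rewrite mulr_gt0.
  rewrite /a; lra.
near=> delta.
have d0 : 0 < delta by near: delta; exact: nbhs_right_gt.
have d1 : delta < 1 by near: delta; exact: nbhs_right_lt.
have d01 : 0 < delta < 1 by rewrite d0 d1.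
(* Each competitor may take a third of exp(phi t / delta). The third that remains is paid for by one
   half of e, the factor exp(t a / delta) by the other. *)
have t3 : (0 : R) < 3^-1 by rewrite invr_gt0.
have b1 : expR (La u - phi u) * expR (- (phi t - phi u) / delta) <= 3^-1.
  by near: delta; exact: near_expR_le.
have b2 : expR (La s - phi s) * expR (- (phi t - phi s + h * a) / delta) <= 3^-1.
  by near: delta; exact: near_expR_le.
have b3 : 1 * expR (- (e / 2) / delta) <= 3^-1.
  by near: delta; apply: near_expR_le => //; lra.
have dn0 : delta != 0 by rewrite gt_eqF.
have t_le0 : t <= 0 by rewrite /t; lra.
have := p_ge d01 t_le0 (ltW h0) (ltW a0).
have -> : t + h = u by rewrite /t /u; ring.
have -> : t - h = s by rewrite /t /s; ring.
have Zt := Z_ge t d01; have Zu := Z_le u d01; have Zs := Z_le s d01.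
set q := p delta; set E := expR (phi t / delta).
have E0 : 0 < E := expR_gt0 _.
have Zu' : Z delta u <= E * 3^-1.
  apply: le_trans Zu _; apply: le_trans (_ : E * _ <= _); last first.
    by apply: ler_wpM2l b1; exact: ltW.
  by rewrite -!expRD ler_expR le_eqVlt; apply/orP; left; apply/eqP; field.
have Zs' : expR (- h * a / delta) * Z delta s <= E * 3^-1.
  apply: (@le_trans _ _ (expR (- h * a / delta) *
      expR (((1 - delta) * phi s + delta * La s) / delta))).
    by rewrite ler_wpM2l ?expR_ge0.
  apply: le_trans (_ : E * _ <= _); last first.
    by apply: ler_wpM2l b2; exact: ltW.
  by rewrite -!expRD ler_expR le_eqVlt; apply/orP; left; apply/eqP; field.
move=> H.
have Hq : E * 3^-1 <= expR (- t * a / delta) * q by rewrite -/E in Zt; lra.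
have Hq2 : expR (t * a / delta) * (E * 3^-1) <= q.
  have := ler_wpM2l (expR_ge0 (t * a / delta)) Hq.
  by rewrite (mulrA _ _ q) -expRD !mulNr subrr expR0 mul1r.
apply: le_trans Hq2.
apply: (@le_trans _ _
  (expR (t * a / delta) * (E * expR (- (e / 2) / delta)))); last first.
  by rewrite mul1r in b3; rewrite ler_wpM2l ?expR_ge0// ler_wpM2l// ltW.
rewrite -!expRD ler_expR -!mulrDl ler_wpM2r ?invr_ge0 ?(ltW d0)//; lra.
Unshelve. all: by end_near. Qed.

Lemma rate_cvg :
  (delta%:E * lne (p delta)%:E)%E @[delta --> 0^'+] --> (phi ts)%:E.
Proof.
suff : delta * ln (p delta) @[delta --> 0^'+] --> phi ts.
  move=> h; have : (delta * ln (p delta))%:E @[delta --> 0^'+] --> (phi ts)%:E.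
    by apply: cvg_EFin => //; exact: nearW.
  (* [rate_lower] also makes p positive near 0, where [lne] agrees with the real logarithm. *)
  apply: cvg_trans; apply: near_eq_cvg; near=> delta.
  have lo : expR ((phi ts - 1) / delta) <= p delta by near: delta; exact: rate_lower.
  by rewrite lne_EFin//; exact: lt_le_trans (expR_gt0 _) lo.
apply/cvgrPdist_le => e e0; near=> delta.
have lo : expR ((phi ts - e) / delta) <= p delta by near: delta; exact: rate_lower.
have up : p delta <= expR ((phi ts + e) / delta) by near: delta; exact: rate_upper.
have d0 : 0 < delta by near: delta; exact: nbhs_right_gt.
have p0 : 0 < p delta := lt_le_trans (expR_gt0 _) lo.
have {}lo : (phi ts - e) / delta <= ln (p delta).
  by rewrite -ler_expR lnK ?posrE.
have {}up : ln (p delta) <= (phi ts + e) / delta.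
  by rewrite -ler_expR lnK ?posrE.
rewrite ler_pdivrMr// in lo; rewrite ler_pdivlMr// in up.
by rewrite ler_norml; apply/andP; split; lra.
Unshelve. all: by end_near. Qed.

End rate.

(** * Integrals determined by a weighted image measure *)

Section weighted_integral.
Local Open Scope ereal_scope.
Import HBNNSimple.
Context (R : realType) (dX : measure_display) (X : measurableType dX).

(** The right-hand side sees m, Y and G only through the weights of the preimages Y^-1(A); this is
    what makes [eq_integral_weighted] immediate. *)
Lemma integral_weightedE (d : measure_display) (T : measurableType d)
    (m : {measure set T -> \bar R}) (Y : T -> X) (G : T -> R) (h : X -> \bar R)
    (mh : measurable_fun setT h) :
  measurable_fun setT Y -> measurable_fun setT G ->
  (forall x, 0 <= G x)%R -> (forall y, 0 <= h y) ->
  \int[m]_x ((G x)%:E * h (Y x)) =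
  limn (fun n => \sum_(y \in range (nnsfun_approx measurableT mh n))
    y%:E * \int[m]_(x in Y @^-1` (nnsfun_approx measurableT mh n @^-1` [set y])) (G x)%:E).
Proof.
move=> mY mG G0 h0; pose a := nnsfun_approx measurableT mh.
have cvga x : (a n (Y x))%:E @[n --> \oo] --> h (Y x).
  by apply: (@cvg_nnsfun_approx _ _ _ _ measurableT _ mh (fun x _ => h0 x)).
have maY n : measurable_fun setT (fun x => a n (Y x)).
  by apply: measurableT_comp.
transitivity (limn (fun n => \int[m]_x ((G x)%:E * (a n (Y x))%:E))).
  rewrite -monotone_convergence//.
  - apply: eq_integral => x _; apply/esym/cvg_lim => //.
    exact: cvgeZl.
  - move=> n; apply: emeasurable_funM; exact/measurable_EFinP.
  - by move=> n x _; rewrite mule_ge0// lee_fin.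
  - move=> x _ i j ij /=; rewrite lee_wpmul2l ?lee_fin//.
    exact/lefP/nd_nnsfun_approx.
apply/congr_lim/funext => n; rewrite -/a.
transitivity (\int[m]_x (\sum_(y \in range (a n))
    ((y * \1_(a n @^-1` [set y]) (Y x))%:E * (G x)%:E))).
  apply: eq_integral => x _.
  rewrite muleC fimfunE -fsumEFin// ge0_mule_fsuml// => y.
  exact: nnfun_muleindic_ge0.
have mind y : measurable_fun setT (fun x => \1_(a n @^-1` [set y]) (Y x) : R).
  by apply: measurableT_comp => //; exact: measurable_indic.
rewrite ge0_integral_fsum//; last 2 first.
- move=> y; apply: emeasurable_funM; apply/measurable_EFinP => //.
  exact: measurable_funM.
- by move=> y x _; rewrite mule_ge0 ?lee_fin// -lee_fin nnfun_muleindic_ge0.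
apply: eq_fsbigr => y _.
have [y0|y0] := ltP y 0%R.
  rewrite preimage_nnfun0// preimage_set0 integral_set0 mule0.
  by apply: integral0_eq => x _; rewrite indic0 mulr0 mul0e.
under eq_integral do rewrite EFinM -muleA.
rewrite ge0_integralZl//; last 2 first.
- apply: emeasurable_funM; exact/measurable_EFinP.
- by move=> x _; rewrite mule_ge0// lee_fin.
congr (_ * _); rewrite [RHS]integral_mkcond; apply: eq_integral => x _.
rewrite patchE indicE; have -> : (Y x \in a n @^-1` [set y]) =
  (x \in Y @^-1` (a n @^-1` [set y])) by apply/idP/idP; rewrite !inE.
by case: ifP => _; rewrite ?mul1e ?mul0e.
Qed.

(** Serves twice: to pass from the law of a signal to its density, and to split off an independent
    factor, with G2 constant. *)
Lemma eq_integral_weighted (d1 d2 : measure_display)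
    (T1 : measurableType d1) (T2 : measurableType d2)
    (m1 : {measure set T1 -> \bar R}) (m2 : {measure set T2 -> \bar R})
    (Y1 : T1 -> X) (Y2 : T2 -> X) (G1 : T1 -> R) (G2 : T2 -> R) (h : X -> \bar R) :
  measurable_fun setT Y1 -> measurable_fun setT Y2 ->
  measurable_fun setT G1 -> measurable_fun setT G2 ->
  (forall x, 0 <= G1 x)%R -> (forall x, 0 <= G2 x)%R ->
  (forall A, measurable A ->
    \int[m1]_(x in Y1 @^-1` A) (G1 x)%:E = \int[m2]_(x in Y2 @^-1` A) (G2 x)%:E) ->
  measurable_fun setT h -> (forall y, 0 <= h y) ->
  \int[m1]_x ((G1 x)%:E * h (Y1 x)) = \int[m2]_x ((G2 x)%:E * h (Y2 x)).
Proof.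
move=> mY1 mY2 mG1 mG2 G10 G20 eqA mh h0.
rewrite !(integral_weightedE _ mh)//.
apply/congr_lim/funext => n; apply: eq_fsbigr => y _; congr (_ * _).
exact/eqA/measurable_funPTI.
Qed.

End weighted_integral.

(** * Expectations of products of independent variables *)

Section independence.
Local Open Scope ereal_scope.
Context (R : realType) (dO : measure_display) (Omega : measurableType dO)
  (P : probability Omega R) (Y : nat -> Omega -> R)
  (mY : forall m, measurable_fun setT (Y m))
  (Y_indep : mutually_independent P Y).

Lemma expectation_prod (n : nat) (h : nat -> R -> R) (e : nat -> R) :
  (forall m, measurable_fun setT (h m)) -> (forall m y, 0 <= h m y)%R ->
  (forall m, \int[P]_x (h m (Y m x))%:E = (e m)%:E) ->
  \int[P]_x (\prod_(m < n) h m (Y m x))%:E = (\prod_(m < n) e m)%:E.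
Proof.
move=> mh h0 he.
have mpre m A : measurable A -> measurable (Y m @^-1` A).
  by move=> mA; rewrite -[X in measurable X]setTI; exact: mY.
have mbig (J : seq nat) A : (forall i, measurable (A i)) ->
    measurable (\bigcap_(i in [set` J]) (Y i @^-1` A i)).
  move=> mA; apply: fin_bigcap_measurable => // i _; exact: mpre.
have mprod k : measurable_fun setT (fun x => \prod_(m < k) h m (Y m x))%R.
  by apply: measurable_prod => i _; exact: measurableT_comp.
have prod0 k x : (0 <= \prod_(m < k) h m (Y m x))%R by rewrite prodr_ge0.
have e0 m : (0 <= e m)%R.
  by rewrite -lee_fin -he integral_ge0// => x _; rewrite lee_fin.
(* Replace the indicators of the independent events by the h m one at a time. *)
suff gen k : forall (J : seq nat) (A : nat -> set R), uniq J ->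
    {in J, forall j, (k <= j)%N} -> (forall i, measurable (A i)) ->
    \int[P]_(x in \bigcap_(i in [set` J]) (Y i @^-1` A i))
      (\prod_(m < k) h m (Y m x))%:E =
    (\prod_(m < k) e m)%:E * \prod_(j <- J) P (Y j @^-1` A j).
  have := gen n [::] (fun=> setT) isT; rewrite big_nil mule1 => <- //.
  by rewrite set_nil bigcap_set0.
elim: k => [|k IH] J A uJ kJ mA.
  under eq_integral do rewrite big_ord0.
  by rewrite integral_cst//; [rewrite big_ord0 !mul1e; exact: Y_indep|exact: mbig].
rewrite big_ord_recr/=.
set B := \bigcap_(i in [set` J]) _; have mB : measurable B by exact: mbig.
pose c := (\prod_(m < k) e m)%:E * \prod_(j <- J) P (Y j @^-1` A j).
have c0 : 0 <= c.
  rewrite mule_ge0 ?lee_fin ?prodr_ge0//.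
  by elim/big_ind : _ => // x y; exact: mule_ge0.
have cfin : c \is a fin_num.
  rewrite fin_numM//; elim/big_ind : _ => // [x y|i _]; first exact: fin_numM.
  exact: fin_num_measure (mpre _ _ (mA i)).
transitivity (\int[P]_x (((\1_B x * \prod_(m < k) h m (Y m x))%R)%:E * (h k (Y k x))%:E)).
  rewrite integral_mkcond; apply: eq_integral => x _; rewrite patchE indicE.
  case: ifP => _; last by rewrite mul0r mul0e.
  by rewrite big_ord_recr/= mul1r EFinM.
(* Under the weight 1_B times the first k factors, the image of P by Y k is c times its law: this is
   the induction hypothesis for k :: J, with an arbitrary event C attached to k. *)
rewrite (@eq_integral_weighted _ _ _ _ _ _ _ P P (Y k) (Y k) _ (fun=> fine c)
  (EFin \o h k))//.
- rewrite ge0_integralZl//; last 3 first.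
  + by apply/measurable_EFinP; exact: measurableT_comp.
  + by move=> x _; rewrite lee_fin.
  + by rewrite lee_fin fine_ge0.
  rewrite he fineK// /c EFinM -!muleA; congr (_ * _); exact: muleC.
- by apply: measurable_funM => //; exact: measurable_indic.
- by move=> x; rewrite mulr_ge0.
- by move=> x; rewrite fine_ge0.
- move=> C mC.
  have kJ' : k \notin J by apply/negP => /kJ; rewrite ltnn.
  pose A' i := if i == k then C else A i.
  have A'J : {in J, A' =1 A}.
    by move=> i iJ; rewrite /A'; case: eqP => // ik; rewrite -ik iJ in kJ'.
  have := IH (k :: J) A'; rewrite /= kJ' uJ => /(_ isT) IH'.
  rewrite integral_cst ?fineK//; last exact: mpre.
  transitivity (\int[P]_(x in \bigcap_(i in [set` k :: J]) (Y i @^-1` A' i))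
      (\prod_(m < k) h m (Y m x))%:E).
    rewrite integral_mkcond [RHS]integral_mkcond; apply: eq_integral => x _.
    rewrite !patchE indicE.
    have -> : (x \in \bigcap_(i in [set` k :: J]) (Y i @^-1` A' i)) =
        (x \in Y k @^-1` C) && (x \in B).
      apply/idP/andP; rewrite !inE/=.
        move=> H; split; first by have := H k; rewrite /A' eqxx/=; apply; rewrite mem_head.
        by move=> i /= iJ; rewrite -(A'J i iJ); apply: H => /=; rewrite in_cons iJ orbT.
      move=> [Hk HB] i /=; rewrite in_cons => /predU1P[->|iJ]; first by rewrite /A' eqxx.
      by rewrite /preimage/= A'J//; exact: HB.
    by case: (x \in Y k @^-1` C) => //=; case: (x \in B); rewrite ?mul1r ?mul0r.
  rewrite IH'.
  + rewrite big_cons /c -muleA; congr (_ * _).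
    have -> : A' k = C by rewrite /A' eqxx.
    rewrite muleC; congr (_ * _).
    by apply: eq_big_seq => i iJ; rewrite A'J.
  + by move=> j; rewrite in_cons => /predU1P[->//|/kJ/ltnW].
  + by move=> i; rewrite /A'; case: ifP.
- by apply/measurable_EFinP.
- by move=> y; rewrite lee_fin.
Qed.

End independence.

(** * Convexity of exp and measurability of pointwise limits *)

(** The tangent at the barycentre, averaged over a and b. *)
Lemma expR_convex (R : realType) (p a b : R) : 0 <= p <= 1 ->
  expR (p * a + (1 - p) * b) <= p * expR a + (1 - p) * expR b.
Proof.
move=> /andP[p0 p1]; set c := p * a + (1 - p) * b.
have tangent x : expR c * (1 + (x - c)) <= expR x.
  by rewrite -[in leRHS](subrK c x) [leRHS]expRD mulrC ler_wpM2r ?expR_ge0// expR_ge1Dx.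
have q0 : 0 <= 1 - p by lra.
have := lerD (ler_wpM2l p0 (tangent a)) (ler_wpM2l q0 (tangent b)).
apply: le_trans; rewrite le_eqVlt; apply/orP; left; apply/eqP.
by rewrite /c; ring.
Qed.

(** [lim] is total, so divergence has to be covered too: convergence holds exactly where the upper
    and lower limits agree and are finite, and elsewhere the value is [point]. *)
Lemma measurable_limn (d : measure_display) (T : measurableType d)
    (R : realType) (u : nat -> T -> R) :
  (forall n, measurable_fun setT (u n)) ->
  measurable_fun setT (fun x => limn (u^~ x)).
Proof.
move=> mu.
pose v n x := (u n x)%:E.
have mv n : measurable_fun setT (v n) by exact/measurable_EFinP.
pose U x := limn_esup (v^~ x); pose L x := limn_einf (v^~ x).
have mU : measurable_fun setT U by exact: measurable_fun_limn_esup.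
have mL : measurable_fun setT L.
  have -> : L = (fun x => - limn_esup ((fun n y => - v n y)%E^~ x))%E.
    apply/funext => x; rewrite -limn_einfN; congr limn_einf.
    by apply/funext => n; rewrite [RHS]oppeK.
  apply: measurableT_comp => //; apply: measurable_fun_limn_esup => n.
  exact: measurableT_comp.
pose D x := (U x == L x) && (U x \is a fin_num).
have cvgD x : reflect (cvgn (u^~ x)) (D x).
  apply: (iffP idP).
    move=> /andP[/eqP UL Ufin].
    have : v^~ x @ \oo --> U x.
      apply: (@squeeze_cvge _ _ _ _ (einfs (v^~ x)) _ (esups (v^~ x))).
      - apply: nearW => n; apply/andP; split.
          by apply: ereal_inf_lbound; exists n => /=.
        by apply: ereal_sup_ubound; exists n => /=.
      - by rewrite UL /L limn_einf_lim; exact: is_cvg_einfs.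
      - by rewrite /U limn_esup_lim; exact: is_cvg_esups.
    rewrite -(fineK Ufin) => /fine_cvgP[_ h].
    by apply/cvg_ex; exists (fine (U x)).
  move=> cu.
  have : v^~ x @ \oo --> (limn (u^~ x))%:E by apply: cvg_EFin => //; exact: nearW.
  by move=> /cvg_limn_einf_sup[h1 h2]; rewrite /D /U /L h1 h2 eqxx.
have mD : measurable_fun setT D.
  apply: measurable_and; first exact: measurable_fun_eqe.
  apply: (measurable_fun_bool true).
  exact: emeasurable_fin_num.
have -> : (fun x => limn (u^~ x)) = (fun x => if D x then fine (U x) else point).
  apply/funext => x; case: cvgD => [cu|cu].
    have : v^~ x @ \oo --> (limn (u^~ x))%:E by apply: cvg_EFin => //; exact: nearW.
    by move=> /cvg_limn_einf_sup[_ h]; rewrite /U h.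
  exact: dvgP.
apply: measurable_fun_ifT => //.
exact: measurableT_comp.
Qed.

(** * Moment generating function of the discounted series *)

Section discounted_sum.
Context (R : realType) (dO : measure_display) (Omega : measurableType dO)
  (P : probability Omega R) (Y : nat -> Omega -> R) (M : R -> R)
  (mY : forall m, measurable_fun setT (Y m))
  (Y_indep : mutually_independent P Y)
  (Y_mgf : forall m t, (\int[P]_x (expR (t * Y m x))%:E = (M t)%:E)%E).

Definition discounted_sum (q : R) (x : Omega) : R :=
  \big[+%R/0]_(0 <= m <oo) (q ^+ m * Y m x).

Lemma measurable_discounted_sum q : measurable_fun setT (discounted_sum q).
Proof.
apply: measurable_limn => n; apply: measurable_sum => m _.
exact: measurable_funM.
Qed.

Context (q : R) (q0 : 0 < q) (q1 : q < 1).

Let S n x : R := \sum_(m < n) q ^+ m * `|Y m x|.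

Let expS s n x : expR (s * S n x) = \prod_(m < n) expR (s * q ^+ m * `|Y m x|).
Proof.
by rewrite /S mulr_sumr expR_sum; apply: eq_bigr => m _; rewrite mulrA.
Qed.

Let mS n : measurable_fun setT (S n).
Proof.
by apply: measurable_sum => m; apply: measurable_funM => //; exact: measurableT_comp.
Qed.

Let S_nd x m n : (m <= n)%N -> S m x <= S n x.
Proof.
move=> mn; rewrite /S -(subnKC mn) big_split_ord/= lerDl sumr_ge0// => i _.
by rewrite mulr_ge0// exprn_ge0// ltW.
Qed.

Let mgf_abs_ge0 s : 0 <= M s + M (- s).
Proof.
by rewrite addr_ge0// -lee_fin -(Y_mgf 0) integral_ge0// => x _; rewrite lee_fin expR_ge0.
Qed.

(** Convexity with p = q ^ m gives exp(p s |y|) <= 1 + p (exp(s y) + exp(- s y)), and 1 + x <= exp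
    x. The factor q ^ m in the exponent makes the product over m bounded. *)
Let mgf_abs_le s (m : nat) : 0 <= s ->
  (\int[P]_x (expR (s * q ^+ m * `|Y m x|))%:E <=
   (expR (q ^+ m * (M s + M (- s))))%:E)%E.
Proof.
move=> s0; set p := q ^+ m.
have p0 : 0 <= p by rewrite exprn_ge0// ltW.
have p1 : p <= 1 by rewrite exprn_ile1// ltW.
have mexp t : measurable_fun setT (fun x => (expR (t * Y m x))%:E).
  apply/measurable_EFinP; apply: measurableT_comp => //; exact: measurable_funM.
apply: (@le_trans _ _ (\int[P]_x
   ((1 : R)%:E + p%:E * ((expR (s * Y m x))%:E + (expR (- s * Y m x))%:E)))%E).
  apply: ge0_le_integral => //=.
  - apply/measurable_EFinP; apply: measurableT_comp => //.
    by apply: measurable_funM => //; exact: measurableT_comp.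
  - apply: emeasurable_funD => //; apply: emeasurable_funM => //; exact: emeasurable_funD.
  move=> x _; rewrite -!EFinD lee_fin.
  have p01 : 0 <= p <= 1 by rewrite p0 p1.
  have := expR_convex (s * `|Y m x|) 0 p01; rewrite mulr0 addr0 expR0 mulr1.
  rewrite mulrCA mulrA => h; apply: le_trans h _.
  have : p * expR (s * `|Y m x|) <= p * (expR (s * Y m x) + expR (- s * Y m x)).
    rewrite ler_wpM2l//; case: (ger0P (Y m x)) => _.
      by rewrite lerDl expR_ge0.
    by rewrite mulrN -mulNr lerDr expR_ge0.
  lra.
rewrite ge0_integralD//; last 2 first.
- by move=> x _; rewrite mule_ge0 ?lee_fin// addr_ge0 ?expR_ge0.
- apply: emeasurable_funM => //; exact: emeasurable_funD.
rewrite ge0_integralZl//; last 2 first.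
- exact: emeasurable_funD.
- by move=> x _; rewrite lee_fin addr_ge0 ?expR_ge0.
rewrite ge0_integralD//.
rewrite !Y_mgf integral_cst//= probability_setT mule1.
have -> : (1 + p%:E * ((M s)%:E + (M (- s))%:E) = (1 + p * (M s + M (- s)))%:E)%E by [].
by rewrite lee_fin expR_ge1Dx.
Qed.

(** Dominates exp(t Tn) for all n when |t| = s. It is extended-valued because almost everywhere
    finiteness is only a consequence of its integrability. *)
Let W s x : \bar R := limn (fun n => (expR (s * S n x))%:E).

Let expS_nd s x : 0 <= s -> nondecreasing_seq (fun n => (expR (s * S n x))%:E).
Proof.
move=> s0 m n mn; rewrite lee_fin ler_expR ler_wpM2l//; exact: S_nd.
Qed.

Let W_ge s n x : 0 <= s -> ((expR (s * S n x))%:E <= W s x)%E.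
Proof.
move=> s0; rewrite /W; have /cvg_lim -> // := ereal_nondecreasing_cvgn (expS_nd x s0).
by apply: ereal_sup_ubound; exists n.
Qed.

Let mexpS s n : measurable_fun setT (fun x => (expR (s * S n x))%:E).
Proof.
by apply/measurable_EFinP; apply: measurableT_comp => //; exact: measurable_funM.
Qed.

Let mW s : 0 <= s -> measurable_fun setT (W s).
Proof.
move=> s0; apply: (@emeasurable_fun_cvg _ _ _ _ (fun n x => (expR (s * S n x))%:E)) => // x _.
exact: ereal_nondecreasing_is_cvgn (expS_nd x s0).
Qed.

Let W_integrable s : 0 <= s -> P.-integrable setT (W s).
Proof.
move=> s0; apply/integrableP; split; first exact: mW.
pose k := M s + M (- s).
have W0 x : (0 <= W s x)%E.
  by apply: le_trans (W_ge 0 x s0); rewrite lee_fin expR_ge0.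
under eq_integral do rewrite gee0_abs//.
rewrite /W monotone_convergence//; last by move=> x _; exact: expS_nd.
(* The partial sums of q ^ m stay below 1 / (1 - q). *)
apply: (@le_lt_trans _ _ (expR ((1 - q)^-1 * k))%:E); last exact: ltry.
apply: lime_le.
  apply: ereal_nondecreasing_is_cvgn => m n mn; apply: ge0_le_integral => //=.
  by move=> x _; exact: expS_nd.
apply: nearW => n.
under eq_integral do rewrite expS.
pose e m := fine (\int[P]_x (expR (s * q ^+ m * `|Y m x|))%:E).
have eE m : (\int[P]_x (expR (s * q ^+ m * `|Y m x|))%:E = (e m)%:E)%E.
  rewrite /e fineK// ge0_fin_numE.
    by apply: le_lt_trans (mgf_abs_le m s0) _; exact: ltry.
  by apply: integral_ge0 => x _; rewrite lee_fin expR_ge0.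
have := @expectation_prod _ _ _ _ _ mY Y_indep n (fun m y => expR (s * q ^+ m * `|y|)) e.
move=> -> //.
rewrite lee_fin; apply: (@le_trans _ _ (\prod_(m < n) expR (q ^+ m * k))).
  apply: ler_prod => m _; rewrite -!lee_fin -eE mgf_abs_le// andbT.
  by apply: integral_ge0 => x _; rewrite lee_fin expR_ge0.
rewrite -expR_sum ler_expR -mulr_suml ler_wpM2r ?mgf_abs_ge0//.
have := subrX1 q n; have qn : 0 <= q ^+ n by rewrite exprn_ge0// ltW.
move=> h; rewrite -[leRHS]mul1r ler_pdivlMr ?subr_gt0//; lra.
by move=> m; apply: measurableT_comp => //; exact: measurable_funM.
Qed.

Let Tn n x : R := \sum_(0 <= m < n) q ^+ m * Y m x.

(** W 1 is integrable, hence almost everywhere finite, and S <= exp S makes it a bound on the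
    partial sums of absolute values. *)
Let ae_cvg : {ae P, forall x, setT x -> Tn^~ x @ \oo --> discounted_sum q x}.
Proof.
have := integrable_ae measurableT (W_integrable ler01).
apply: filterS => x /(_ I) Wfin _.
have : cvgn (series (fun m => `|q ^+ m * Y m x|)).
  apply: nondecreasing_is_cvgn.
    by apply: nondecreasing_series => m _ _.
  exists (fine (W 1 x)) => _ [n _ <-].
  have := W_ge n x ler01; rewrite -(fineK Wfin) lee_fin mul1r.
  apply: le_trans; apply: le_trans (expR_ge1Dx _); rewrite /series/= big_mkord /S.
  rewrite ler_wpDl// le_eqVlt; apply/orP; left; apply/eqP; apply: eq_bigr => m _.
  by rewrite normrM ger0_norm// exprn_ge0// ltW.
by move=> /normed_cvg.
Qed.

Lemma mgf_discounted_sum t :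
  (\int[P]_x (expR (t * discounted_sum q x))%:E)%E \is a fin_num /\
  (\prod_(m < n) M (t * q ^+ m))%:E @[n --> \oo] -->
    (\int[P]_x (expR (t * discounted_sum q x))%:E)%E.
Proof.
have mTn n : measurable_fun setT (Tn n).
  by apply: measurable_sum => m; exact: measurable_funM.
have mf n : measurable_fun setT (fun x => (expR (t * Tn n x))%:E).
  by apply/measurable_EFinP; apply: measurableT_comp => //; exact: measurable_funM.
have [||||fi _ fcvg] := @dominated_convergence _ _ _ P setT measurableT
    (fun n x => (expR (t * Tn n x))%:E)
    (fun x => (expR (t * discounted_sum q x))%:E) (W `|t|) mf.
- apply/measurable_EFinP; apply: measurableT_comp => //; apply: measurable_funM => //.
  exact: measurable_discounted_sum.
- have := ae_cvg; apply: filterS => x /(_ I) Tx _.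
  have h : expR (t * Tn n x) @[n --> \oo] --> expR (t * discounted_sum q x).
    have tT : t * Tn n x @[n --> \oo] --> t * discounted_sum q x by exact: cvgMl_tmp.
    exact: (cvg_comp _ _ tT (@continuous_expR R _)).
  by apply: cvg_EFin => //; exact: nearW.
- exact: W_integrable.
- apply: aeW => x n _; rewrite gee0_abs ?lee_fin ?expR_ge0//.
  apply: le_trans (W_ge n x (normr_ge0 t)); rewrite lee_fin ler_expR.
  apply: (le_trans (ler_norm _)); rewrite normrM ler_wpM2l//.
  apply: (le_trans (ler_norm_sum _ _ _)); rewrite big_mkord.
  by apply: ler_sum => m _; rewrite normrM ger0_norm// exprn_ge0// ltW.
split; first exact: integrable_fin_num.
apply: cvg_trans fcvg; apply: near_eq_cvg; apply: nearW => n /=.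
have := @expectation_prod _ _ _ _ _ mY Y_indep n (fun m y => expR (t * q ^+ m * y))
  (fun m => M (t * q ^+ m)).
move=> <- //.
- apply: eq_integral => x _; rewrite /Tn big_mkord mulr_sumr expR_sum.
  by congr (_%:E); apply: eq_bigr => m _; rewrite mulrA.
- by move=> m; apply: measurableT_comp => //; exact: measurable_funM.
Qed.

End discounted_sum.

(** * Riemann sums on the geometric grid *)

Section telescoping.
Context (R : realType) (M phi : R -> R) (c : R).
Local Notation La := (fun t => ln (M t)).
Local Notation g := (slope La c).
Context (M_gt0 : forall t, 0 < M t) (M0 : M 0 = 1)
  (La_scale : forall p s, 0 <= p <= 1 -> La (p * s) <= p * La s)
  (phi_sub : subgradient phi g) (phi0 : phi 0 = 0).

Let slopeM b : g b * b = La b.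
Proof.
rewrite /slope; case: eqVneq => [->|b0]; last by rewrite divfK.
by rewrite mulr0 /= M0 ln1.
Qed.

Context (delta t z : R) (d0 : 0 < delta) (d1 : delta < 1)
  (zlim : \prod_(m < n) M (t * (1 - delta) ^+ m) @[n --> \oo] --> z).
Local Notation q := (1 - delta).

Let q0 : 0 < q. Proof. by rewrite subr_gt0. Qed.
Let q1 : q < 1. Proof. by rewrite ltrBlDr ltrDl. Qed.

Let prodE n : \prod_(m < n) M (t * q ^+ m) = expR (\sum_(m < n) La (t * q ^+ m)).
Proof. by rewrite expR_sum; apply: eq_bigr => m _; rewrite lnK ?posrE. Qed.

Let lim_expR (a b : R) : expR ((a + b * q ^+ n) / delta) @[n --> \oo] --> expR (a / delta).
Proof.
have qn : q ^+ n @[n --> \oo] --> (0 : R).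
  by apply: cvg_expr; rewrite ger0_norm// ltW.
have h : (a + b * q ^+ n) / delta @[n --> \oo] --> (a + b * 0) / delta.
  apply: cvgMr_tmp; apply: cvgD; first exact: cvg_cst.
  exact: cvgMl_tmp.
rewrite mulr0 addr0 in h.
exact: (cvg_comp _ _ h (@continuous_expR R _)).
Qed.

(* The sums of ln M along the geometric grid t q^m are Riemann sums of the
   slope, with the value at the right end of each cell. *)
Lemma discounted_mgf_ge : expR (phi t / delta) <= z.
Proof.
apply: (ler_cvg_to (@lim_expR (phi t) (- La t)) zlim).
apply: nearW => n; rewrite prodE ler_expR ler_pdivrMr//.
have step b : phi b - phi (b * q) <= delta * La b.
  have := phi_sub (b * q) b; have -> : b * q - b = - (b * delta) by ring.
  by rewrite mulrN mulrA slopeM /=; lra.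
have sums : phi t - phi (t * q ^+ n) <= (\sum_(m < n) La (t * q ^+ m)) * delta.
  elim: n => [|n IH]; first by rewrite big_ord0 mul0r mulr1 subrr.
  rewrite big_ord_recr/= mulrDl; have := step (t * q ^+ n).
  by rewrite -mulrA -exprSr /=; lra.
(* The part of the integral between 0 and t q ^ n is O(q ^ n) and vanishes in the limit. *)
have small : phi (t * q ^+ n) <= q ^+ n * La t.
  have := phi_sub 0 (t * q ^+ n); rewrite phi0 sub0r mulrN slopeM.
  have qn : 0 <= q ^+ n <= 1 by rewrite exprn_ge0 ?exprn_ile1// ltW.
  have := La_scale t qn; rewrite (mulrC (q ^+ n) t) /=; lra.
by rewrite /= in small *; lra.
Qed.

(** Here the subgradient is taken at the end b q of the cell that is nearer to 0, and its ratio to b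
    gives the factor 1 - delta. The grid is shifted by one cell, so the term delta ln M(t) of m = 0
    stands apart. *)
Lemma discounted_mgf_le :
  z <= expR (((1 - delta) * phi t + delta * La t) / delta).
Proof.
have zlim1 : \prod_(m < n.+1) M (t * q ^+ m) @[n --> \oo] --> z.
  by have := zlim; rewrite -cvg_shiftS.
apply: (ler_cvg_to zlim1 (@lim_expR (q * phi t + delta * La t) (- (q * c * t)))).
apply: nearW => n; rewrite prodE ler_expR ler_pdivlMr//.
have step b : delta * La (b * q) <= q * (phi b - phi (b * q)).
  have := phi_sub b (b * q); have -> : b - b * q = b * delta by ring.
  have := slopeM (b * q); rewrite /= => <-; have := q0; nra.
have sums : (\sum_(m < n.+1) La (t * q ^+ m)) * delta <=
    q * (phi t - phi (t * q ^+ n)) + delta * La t.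
  elim: n => [|n IH]; first by rewrite big_ord1 expr0 mulr1 /=; lra.
  rewrite big_ord_recr/= mulrDl; have := step (t * q ^+ n).
  by rewrite -mulrA -exprSr /=; rewrite /= in IH; lra.
have := phi_sub (t * q ^+ n) 0; rewrite phi0 subr0 add0r /slope eqxx => small.
have : q * (c * (t * q ^+ n)) <= q * phi (t * q ^+ n) by rewrite ler_wpM2l// ltW.
by rewrite /= in sums *; lra.
Qed.

End telescoping.

(** * Convexity properties of a single moment generating function *)

Section moment_generating_function.
Context (R : realType) (dO : measure_display) (Omega : measurableType dO)
  (P : probability Omega R) (Y : Omega -> R) (M : R -> R) (c : R)
  (mY : measurable_fun setT Y)
  (Y_mgf : forall t, (\int[P]_x (expR (t * Y x))%:E = (M t)%:E)%E)
  (Y_int : P.-integrable setT (EFin \o Y))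
  (Y_mean : (\int[P]_x (Y x)%:E = c%:E)%E).

Let mexp t : measurable_fun setT (fun x => expR (t * Y x)).
Proof. by apply: measurableT_comp => //; exact: measurable_funM. Qed.

Let iexp t : P.-integrable setT (fun x => (expR (t * Y x))%:E).
Proof.
apply/integrableP; split; first exact/measurable_EFinP.
under eq_integral do rewrite gee0_abs ?lee_fin ?expR_ge0//.
by rewrite Y_mgf ltry.
Qed.

Let mgf_combination a b r s : 0 <= r -> 0 <= s ->
  (\int[P]_x (r * expR (a * Y x) + s * expR (b * Y x))%:E =
   (r * M a + s * M b)%:E)%E.
Proof.
move=> r0 s0; under eq_integral do rewrite EFinD !EFinM.
rewrite ge0_integralD//; last 4 first.
- by move=> x _; rewrite mule_ge0 ?lee_fin ?expR_ge0.
- by apply: emeasurable_funM => //; exact/measurable_EFinP.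
- by move=> x _; rewrite mule_ge0 ?lee_fin ?expR_ge0.
- by apply: emeasurable_funM => //; exact/measurable_EFinP.
rewrite !ge0_integralZl//; try exact/measurable_EFinP;
  try by move=> x _; rewrite lee_fin expR_ge0.
by rewrite !Y_mgf.
Qed.

Lemma mgf0 : M 0 = 1.
Proof.
apply: EFin_inj; rewrite -Y_mgf.
under eq_integral do rewrite mul0r expR0.
by rewrite integral_cst//= probability_setT mule1.
Qed.

(** Jensen's inequality: the tangent of exp at c t, evaluated at t Y, integrates to exp(c t). *)
Lemma mgf_ge t : expR (c * t) <= M t.
Proof.
rewrite -lee_fin -Y_mgf; set E := expR (c * t).
have iaff : P.-integrable setT (fun x => (E * t)%:E * (Y x)%:E)%E.
  exact: integrableZl.
have icst : P.-integrable setT (cst (E * (1 - c * t))%:E).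
  exact: finite_measure_integrable_cst.
apply: (@le_trans _ _ (\int[P]_x ((E * (1 - c * t))%:E + (E * t)%:E * (Y x)%:E))%E).
  rewrite integralD// integralZl// Y_mean integral_cst//= probability_setT mule1.
  rewrite -EFinM -EFinD lee_fin le_eqVlt; apply/orP; left; apply/eqP; ring.
apply: le_integral => //; first exact: integrableD.
move=> x _; rewrite -EFinM -EFinD lee_fin.
have := ler_wpM2l (expR_ge0 (c * t)) (expR_ge1Dx (t * Y x - c * t)).
rewrite -/E; have -> : E * expR (t * Y x - c * t) = expR (t * Y x).
  by rewrite /E -expRD addrC subrK.
by apply: le_trans; rewrite le_eqVlt; apply/orP; left; apply/eqP; ring.
Qed.

Lemma mgf_gt0 t : 0 < M t.
Proof. exact: lt_le_trans (expR_gt0 _) (mgf_ge t). Qed.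

Lemma ln_mgf_ge t : c * t <= ln (M t).
Proof. by rewrite -ler_expR lnK ?posrE ?mgf_ge// mgf_gt0. Qed.

Lemma mgf_convex p a b : 0 <= p <= 1 ->
  M (p * a + (1 - p) * b) <= p * M a + (1 - p) * M b.
Proof.
move=> p01; case/andP: (p01) => p0 p1.
rewrite -lee_fin -Y_mgf -mgf_combination ?subr_ge0//.
apply: ge0_le_integral => //=.
- by apply/measurable_EFinP.
- by apply/measurable_EFinP; apply: measurable_funD; exact: measurable_funM.
- move=> x _; rewrite lee_fin mulrDl -!mulrA; exact: expR_convex.
Qed.

(** That is, M(p s) <= M(s)^p. After normalization by l = ln M(s), the bound exp(p (sY - l)) <= p
    exp(sY - l) + 1 - p has a right-hand side of mean 1. *)
Lemma ln_mgf_scale p s : 0 <= p <= 1 -> ln (M (p * s)) <= p * ln (M s).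
Proof.
move=> p01; case/andP: (p01) => p0 p1.
set l := ln (M s); have el : expR l = M s by rewrite lnK// posrE mgf_gt0.
rewrite -ler_expR lnK ?posrE ?mgf_gt0//.
have e0 : 0 <= expR (p * l - l) * p by rewrite mulr_ge0 ?expR_ge0.
have e1 : 0 <= expR (p * l) * (1 - p) by rewrite mulr_ge0 ?expR_ge0// subr_ge0.
apply: (@le_trans _ _ (expR (p * l - l) * p * M s + expR (p * l) * (1 - p) * M 0)).
  rewrite -lee_fin -Y_mgf -mgf_combination//.
  apply: ge0_le_integral => //=.
  - by apply/measurable_EFinP.
  - by apply/measurable_EFinP; apply: measurable_funD; exact: measurable_funM.
  - move=> x _; rewrite lee_fin mul0r expR0 mulr1.
    have := expR_convex (s * Y x - l) 0 p01; rewrite mulr0 addr0 expR0 mulr1 => h.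
    have := ler_wpM2l (expR_ge0 (p * l)) h.
    rewrite -expRD; have -> : p * l + p * (s * Y x - l) = p * s * Y x by ring.
    move=> h2; apply: le_trans h2 _.
    rewrite !expRD !expRN le_eqVlt; apply/orP; left; apply/eqP; ring.
rewrite mgf0 -el expRD expRN mulr1.
have := expR_gt0 l; rewrite lt0r => /andP[l0 _].
by rewrite le_eqVlt; apply/orP; left; apply/eqP; field.
Qed.

(* exp(-nY) dominates n times the negative part of Y. *)
Lemma mgf_le1_negpart0 : (forall t, t < 0 -> M t <= 1) ->
  (\int[P]_x (Num.max 0 (- Y x))%:E = 0)%E.
Proof.
move=> M1; have mneg : measurable_fun setT (fun x => Num.max 0 (- Y x)).
  by apply: measurable_maxr => //; exact: measurableT_comp.
set I := (\int[P]_x _)%E.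
have I0 : (0 <= I)%E by apply: integral_ge0 => x _; rewrite lee_fin le_max lexx.
have nI (n : nat) : (n.+1%:R%:E * I <= 1)%E.
  rewrite -ge0_integralZl//; last 2 first.
  - exact/measurable_EFinP.
  - by move=> x _; rewrite lee_fin le_max lexx.
  apply: (@le_trans _ _ (M (- n.+1%:R))%:E); last by rewrite lee_fin M1// oppr_lt0.
  rewrite -Y_mgf; apply: ge0_le_integral => //=.
  - by move=> x _; rewrite mule_ge0 ?lee_fin// le_max lexx.
  - by apply: emeasurable_funM => //; exact/measurable_EFinP.
  - by apply/measurable_EFinP.
  - move=> x _; rewrite -EFinM lee_fin maxEle; case: ifP => _.
      by rewrite mulrN -mulNr; apply: le_trans (expR_ge1Dx _); rewrite lerDr.
    by rewrite mulr0 expR_ge0.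
have Ifin : I \is a fin_num.
  by rewrite ge0_fin_numE//; have := nI 0; rewrite mul1e => /le_lt_trans; apply; exact: ltry.
move: I0 nI; rewrite -(fineK Ifin); set r := fine I => r0 nr.
rewrite lee_fin in r0; congr (_%:E); apply/eqP; rewrite eq_le r0 andbT leNgt.
apply/negP => rpos.
have [n Hn] : exists n : nat, r^-1 < n%:R.
  by exists (Num.truncn r^-1).+1; rewrite truncnS_gt.
have := nr n; rewrite -EFinM lee_fin leNgt => /negP; apply.
rewrite -ltr_pdivrMr// div1r; apply: lt_trans Hn _; by rewrite ltr_nat.
Qed.

End moment_generating_function.

(** * Decay rate for independent copies *)

Section iid_large_deviations.
Context (R : realType) (dO : measure_display) (Omega : measurableType dO)
  (P : probability Omega R) (Y : nat -> Omega -> R) (M : R -> R) (c : R)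
  (mY : forall m, measurable_fun setT (Y m))
  (Y_indep : mutually_independent P Y)
  (Y_mgf : forall m t, (\int[P]_x (expR (t * Y m x))%:E = (M t)%:E)%E)
  (Y_int : P.-integrable setT (EFin \o Y 0))
  (Y_mean : (\int[P]_x (Y 0 x)%:E = c%:E)%E).
Context (phi : R -> R) (t0 : R)
  (phi_sub : subgradient phi (slope (fun t => ln (M t)) c)) (phi0 : phi 0 = 0).

Let T (delta : R) := discounted_sum Y (1 - delta).

Let A (delta : R) := [set x | delta * T delta x <= 0].

Let mT delta : measurable_fun setT (T delta).
Proof. exact: measurable_discounted_sum. Qed.

Let mA delta : measurable (A delta).
Proof.
rewrite /A; have := @measurable_fun_le _ Omega R setT (fun x => delta * T delta x) (cst 0).
by rewrite setTI; apply => //; exact: measurable_funM.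
Qed.

Let Z delta t := fine (\int[P]_x (expR (t * T delta x))%:E).

Let M0 : M 0 = 1 := mgf0 (Y_mgf 0).
Let M_gt0 : forall t, 0 < M t := mgf_gt0 (mY 0) (Y_mgf 0) Y_int Y_mean.

Let ZE delta t : 0 < delta < 1 ->
  (\int[P]_x (expR (t * T delta x))%:E = (Z delta t)%:E)%E.
Proof.
move=> /andP[d0 d1]; have q0 : 0 < 1 - delta by rewrite subr_gt0.
have q1 : 1 - delta < 1 by rewrite ltrBlDr ltrDl.
by have [/fineK <-] := mgf_discounted_sum mY Y_indep Y_mgf q0 q1 t.
Qed.

Let Z_lim delta t : 0 < delta < 1 ->
  \prod_(m < n) M (t * (1 - delta) ^+ m) @[n --> \oo] --> Z delta t.
Proof.
move=> d01; have /andP[d0 d1] := d01; have q0 : 0 < 1 - delta by rewrite subr_gt0.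
have q1 : 1 - delta < 1 by rewrite ltrBlDr ltrDl.
have [_] := mgf_discounted_sum mY Y_indep Y_mgf q0 q1 t.
by rewrite ZE// => /fine_cvgP[_].
Qed.

Let mexp delta t : measurable_fun setT (fun x => (expR (t * T delta x))%:E).
Proof.
by apply/measurable_EFinP; apply: measurableT_comp => //; exact: measurable_funM.
Qed.

Let p delta := fine (P (A delta)).

Let pE delta : (P (A delta) = (p delta)%:E)%E.
Proof. by rewrite /p fineK// fin_num_measure. Qed.

Let pI delta : (\int[P]_x (\1_(A delta) x)%:E = (p delta)%:E)%E.
Proof. by rewrite integral_indic// setIT; exact: pE. Qed.

Let p_le delta t : 0 < delta < 1 -> t <= 0 -> p delta <= Z delta t.
Proof.
move=> d01 t_le0; rewrite -lee_fin -ZE// -pI; apply: ge0_le_integral => //=.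
  by apply/measurable_EFinP; exact: measurable_indic.
move=> x _; rewrite lee_fin indicE.
case: (boolP (x \in A delta)) => [|_]; last by rewrite expR_ge0.
rewrite inE /A/=; case/andP: d01 => d0 _; rewrite pmulr_rle0// => T0.
apply: le_trans (expR_ge1Dx _); rewrite lerDl.
by rewrite -mulrNN mulr_ge0// oppr_ge0.
Qed.

(** The three terms bound exp(t T) on - a / delta <= T <= 0, on T > 0 and on T < - a / delta,
    respectively. *)
Let p_ge delta t h a : 0 < delta < 1 -> t <= 0 -> 0 <= h -> 0 <= a ->
  Z delta t <= expR (- t * a / delta) * p delta + Z delta (t + h) +
               expR (- h * a / delta) * Z delta (t - h).
Proof.
move=> d01 t_le0 h0 a0; have /andP[d0 _] := d01.
have e0 : 0 <= expR (- t * a / delta) by exact: expR_ge0.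
have e1 : 0 <= expR (- h * a / delta) by exact: expR_ge0.
have mind : measurable_fun setT (fun x => (\1_(A delta) x : R)%:E).
  by apply/measurable_EFinP; exact: measurable_indic.
set r := expR (- t * a / delta) in e0 *; set s := expR (- h * a / delta) in e1 *.
pose F x : \bar R := (r%:E * (\1_(A delta) x)%:E + (expR ((t + h) * T delta x))%:E +
    s%:E * (expR ((t - h) * T delta x))%:E)%E.
have FE : (\int[P]_x F x = (r * p delta + Z delta (t + h) + s * Z delta (t - h))%:E)%E.
  rewrite /F ge0_integralD//; last 4 first.
  - by move=> x _; rewrite adde_ge0 ?mule_ge0 ?lee_fin ?expR_ge0.
  - by apply: emeasurable_funD => //; exact: emeasurable_funM.
  - by move=> x _; rewrite mule_ge0 ?lee_fin ?expR_ge0.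
  - exact: emeasurable_funM.
  rewrite ge0_integralD//; last 2 first.
  - by move=> x _; rewrite mule_ge0 ?lee_fin.
  - exact: emeasurable_funM.
  rewrite !ge0_integralZl//; try by move=> x _; rewrite lee_fin ?expR_ge0.
  by rewrite pI !ZE.
rewrite -lee_fin -FE -ZE//; apply: ge0_le_integral => //=.
- apply: emeasurable_funD; last exact: emeasurable_funM.
  by apply: emeasurable_funD => //; exact: emeasurable_funM.
move=> x _; rewrite /F -!EFinM -!EFinD lee_fin; set y := T delta x.
have [y0|y0] := ltP 0 y.
  have : expR (t * y) <= expR ((t + h) * y).
    by rewrite ler_expR ler_wpM2r ?(ltW y0)// lerDl.
  have : 0 <= r * \1_(A delta) x by rewrite mulr_ge0.
  have : 0 <= s * expR ((t - h) * y) by rewrite mulr_ge0 ?expR_ge0.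
  lra.
have e2 : 0 <= expR ((t + h) * y) by exact: expR_ge0.
have -> : \1_(A delta) x = 1 :> R.
  by rewrite indicE mem_set// /A/= pmulr_rle0.
have [ya|ya] := leP (- (a / delta)) y.
  have : expR (t * y) <= r.
    rewrite ler_expR; have := ler_wnM2l t_le0 ya.
    by rewrite mulrN mulNr mulrA -mulNr.
  have : 0 <= s * expR ((t - h) * y) by rewrite mulr_ge0 ?expR_ge0.
  lra.
have : expR (t * y) <= s * expR ((t - h) * y).
  rewrite -expRD ler_expR; have := ler_wpM2l h0 (ltW ya).
  rewrite mulrN mulrA -!mulNr; lra.
lra.
Qed.

Lemma iid_rate : t0 < 0 -> 0 < ln (M t0) ->
  (delta%:E * lne (P [set x | (delta * T delta x <= 0)%R]))%E @[delta --> 0^'+] -->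
    (phi (minimizer M))%:E.
Proof.
move=> t0_lt0 Mt0.
have d01 (delta : R) : 0 < delta < 1 -> 0 < delta /\ delta < 1 by move=> /andP[].
have scale := ln_mgf_scale (mY 0) (Y_mgf 0) Y_int Y_mean.
have := @rate_cvg R M phi c t0 M_gt0 M0 (mgf_convex (mY 0) (Y_mgf 0)) scale
  (ln_mgf_ge (mY 0) (Y_mgf 0) Y_int Y_mean) phi_sub t0_lt0 Mt0 p Z.
have Zge delta t : 0 < delta < 1 -> expR (phi t / delta) <= Z delta t.
  move=> dd; have [d0 d1] := d01 _ dd.
  exact: (discounted_mgf_ge M_gt0 M0 scale phi_sub phi0 d0 d1 (@Z_lim delta t dd)).
have Zle delta t : 0 < delta < 1 ->
    Z delta t <= expR (((1 - delta) * phi t + delta * ln (M t)) / delta).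
  move=> dd; have [d0 d1] := d01 _ dd.
  exact: (discounted_mgf_le M_gt0 M0 phi_sub phi0 d0 d1 (@Z_lim delta t dd)).
move=> /(_ Zge Zle p_le p_ge) rate; apply: cvg_trans rate.
by apply: near_eq_cvg; apply: nearW => delta; rewrite -pE.
Qed.

Lemma iid_rate_trivial : (forall m, {ae P, forall x, Y m x = 0}) ->
  (delta%:E * lne (P [set x | (delta * T delta x <= 0)%R]))%E @[delta --> 0^'+] --> 0%E.
Proof.
move=> Y0.
have P1 delta : P (A delta) = 1%E.
  rewrite -(@probability_setT _ _ _ P).
  have mset : measurable [set: Omega] by exact: measurableT.
  have aeA : {ae P, forall x, A delta x}.
    have := ae_foralln Y0; apply: filterS => x Yx.
    rewrite /A/= /T /discounted_sum.
    have -> : (fun n => \sum_(0 <= m < n) (1 - delta) ^+ m * Y m x) = cst 0.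
      by apply/funext => n; rewrite big1// => m _; rewrite Yx mulr0.
    by rewrite lim_cst// mulr0.
  have nA : P (~` A delta) = 0%E.
    apply/negligibleP; first exact: measurableC.
    by move: aeA.
  by rewrite -(setvU (A delta)) measureU//= ?setICl// ?nA ?add0e//; exact: measurableC.
have h : cst (0%E : \bar R) delta @[delta --> (0 : R)^'+] --> (0%E : \bar R).
  exact: cvg_cst.
apply: cvg_trans h; apply: near_eq_cvg; apply: nearW => delta.
by rewrite [P _]P1 lne1 mule0.
Qed.

End iid_large_deviations.

(** * Log-likelihood ratios of one agent, and the sum over agents *)

Section agent.
Context (R : realType) (N : nat) (Theta : finType) (theta1 : Theta)
  (d : 'I_N -> measure_display) (X : forall k, measurableType (d k))
  (mu : forall k, {sigma_finite_measure set (X k) -> \bar R})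
  (supp : forall k, set (X k))
  (f : forall k, X k -> R) (L : forall k, Theta -> X k -> R)
  (dO : measure_display) (Omega : measurableType dO) (P : probability Omega R)
  (xi : forall k, nat -> {RV P >-> X k})
  (f_density : forall k, is_density (mu k) (supp k) (f k))
  (L_density : forall k theta, is_density (mu k) (supp k) (L k theta))
  (xi_law : forall k i (A : set (X k)), measurable A ->
     (distribution P (xi k i) A = \int[mu k]_(x in A) (f k x)%:E)%E)
  (xi_indep : mutually_independent P
     (fun (ki : 'I_N * nat) (w : Omega) => xi ki.1 ki.2 w))
  (theta : Theta)
  (Lambda_fin : forall k t, (Lambda theta1 mu f L k theta t < +oo)%E).

Arguments f : clear implicits.
Arguments L : clear implicits.
Arguments xi : clear implicits.
Arguments xi_law : clear implicits.

Definition mgf (k : 'I_N) (t : R) : R :=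
  fine (expect (mu k) (f k) (fun x => expR (t * llr theta1 L theta x))).

Definition rate (k : 'I_N) : R -> R :=
  integral0 (slope (fun t => ln (mgf k t)) (drift theta1 mu f L k theta)).

Let Y k i (w : Omega) := llr theta1 L theta (xi k i w).

Let f_meas k : measurable_fun setT (f k). Proof. by case: (f_density k). Qed.
Let f_ge0 k x : 0 <= f k x. Proof. by case: (f_density k). Qed.

Lemma density_eq0 k th x : (f k x == 0) = (L k th x == 0).
Proof.
have [_ L0 _ sL] := L_density k th; have [_ f0 _ sf] := f_density k.
have : (0 < f k x) = (0 < L k th x).
  by apply/idP/idP => h; have := congr1 (@^~ x) (etrans sf (esym sL)) => /=;
    [move=> <-|move=> ->].
by rewrite !lt0r f0 L0 !andbT => /negb_inj.
Qed.

(** Valid off the common support as well: both densities vanish there, and [ln] is 0 at 0. *)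
Lemma llrE k (x : X k) :
  llr theta1 L theta x = ln (L k theta1 x) - ln (L k theta x).
Proof.
have [_ L0 _ _] := L_density k theta; have [_ L10 _ _] := L_density k theta1.
rewrite /llr; have e1 := density_eq0 theta1 x; have e2 := density_eq0 theta x.
have [Lx|Lx] := eqVneq (L k theta x) 0.
  have /eqP -> : L k theta1 x == 0 by rewrite -e1 e2 Lx.
  by rewrite Lx mul0r subrr ln0.
by rewrite ln_div ?posrE ?lt0r ?L0 ?L10 ?andbT// -e1 e2.
Qed.

Lemma measurable_llr k : measurable_fun setT (@llr _ _ _ theta1 _ _ L k theta).
Proof.
have [mL _ _ _] := L_density k theta; have [mL1 _ _ _] := L_density k theta1.
rewrite (_ : @llr _ _ _ _ _ _ _ _ _ = fun x => ln (L k theta1 x) - ln (L k theta x)).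
  by apply: measurable_funB; exact: measurableT_comp.
by apply/funext => x; exact: llrE.
Qed.

Let mY k i : measurable_fun setT (Y k i).
Proof. by apply: measurableT_comp => //; exact: measurable_llr. Qed.

Lemma expectation_signal k i (h : X k -> \bar R) : measurable_fun setT h ->
  (forall x, 0 <= h x)%E ->
  (\int[P]_w h (xi k i w) = \int[mu k]_x ((f k x)%:E * h x))%E.
Proof.
move=> mh h0.
have := @eq_integral_weighted R _ (X k) _ _ Omega (X k) P (mu k) (xi k i) id
  (fun=> 1) (f k) h.
under eq_integral do rewrite mul1e.
apply => // A mA; rewrite -(xi_law k i A mA) integral_cst ?mul1e//.
by rewrite -[X in measurable X]setTI; exact: measurable_funPT.
Qed.

Let expR_llr_meas k t :
  measurable_fun setT (fun x : X k => (expR (t * llr theta1 L theta x))%:E).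
Proof.
apply/measurable_EFinP; apply: measurableT_comp => //; apply: measurable_funM => //.
exact: measurable_llr.
Qed.

Lemma expect_mgf k t :
  (expect (mu k) (f k) (fun x => expR (t * llr theta1 L theta x)) = (mgf k t)%:E)%E.
Proof.
rewrite /mgf fineK// ge0_fin_numE.
  have := Lambda_fin k t; rewrite /Lambda; set e := expect _ _ _.
  by rewrite !ltey; apply: contra_neq => ->.
by apply: integral_ge0 => x _; rewrite lee_fin mulr_ge0 ?expR_ge0.
Qed.

Lemma mgf_signal k i t :
  (\int[P]_w (expR (t * llr theta1 L theta (xi k i w)))%:E = (mgf k t)%:E)%E.
Proof.
rewrite -expect_mgf (@expectation_signal k i
  (fun x => (expR (t * llr theta1 L theta x))%:E))//.
Qed.

(** |y| <= exp y + exp(- y), and the moments at 1 and -1 are finite. *)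
Lemma integrable_llr k i :
  P.-integrable setT (EFin \o (fun w => llr theta1 L theta (xi k i w))).
Proof.
apply: (@le_integrable _ _ _ _ _ measurableT _ (fun w =>
    (expR (1 * Y k i w))%:E + (expR (- 1 * Y k i w))%:E)%E).
- apply/measurable_EFinP; exact: mY.
- move=> w _; rewrite /= lee_fin [leRHS]ger0_norm ?addr_ge0 ?expR_ge0//.
  rewrite mul1r mulN1r -/(Y k i w); have := expR_ge1Dx (Y k i w).
  have := expR_ge1Dx (- Y k i w); have := expR_ge0 (Y k i w).
  have := expR_ge0 (- Y k i w); case: (ger0P (Y k i w)); lra.
apply: integrableD => //; apply/integrableP; split;
  try (apply/measurable_EFinP; apply: measurableT_comp => //; exact: measurable_funM);
  under eq_integral do rewrite gee0_abs ?lee_fin ?expR_ge0//;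
  by rewrite mgf_signal ltry.
Qed.

(** [expectation_signal] concerns nonnegative functions, so it is applied to the positive and
    negative parts; the nonnegative factor f moves into each maximum. *)
Lemma mean_llr k i :
  (\int[P]_w (llr theta1 L theta (xi k i w))%:E =
   (drift theta1 mu f L k theta)%:E)%E.
Proof.
have E : (\int[P]_w (llr theta1 L theta (xi k i w))%:E =
    expect (mu k) (f k) (llr theta1 L theta))%E.
  have mllr : measurable_fun setT (EFin \o @llr _ _ _ theta1 _ _ L k theta).
    by apply/measurable_EFinP; exact: measurable_llr.
  have fM x : (f k x * llr theta1 L theta x)%:E =
    ((f k x)%:E * (EFin \o llr theta1 L theta) x)%E by [].
  rewrite /expect integralE [RHS]integralE; congr (_ - _)%E.
    transitivity (\int[P]_w (EFin \o llr theta1 L theta)^\+ (xi k i w))%E.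
      by apply: eq_integral => w _; rewrite !funeposE.
    rewrite expectation_signal//; last exact: measurable_funepos.
    apply: eq_integral => x _; rewrite !funeposE fM -{2}(mule0 (f k x)%:E).
    by rewrite maxe_pMr// lee_fin.
  transitivity (\int[P]_w (EFin \o llr theta1 L theta)^\- (xi k i w))%E.
    by apply: eq_integral => w _; rewrite !funenegE.
  rewrite expectation_signal//; last exact: measurable_funeneg.
  apply: eq_integral => x _; rewrite !funenegE fM -muleN -{2}(mule0 (f k x)%:E).
  by rewrite maxe_pMr// lee_fin.
by rewrite /drift -E fineK//; exact: (integrable_fin_num measurableT (integrable_llr k i)).
Qed.

Lemma mutually_independent_llr k :
  mutually_independent P (fun i w => llr theta1 L theta (xi k i w)).
Proof.
move=> J B uJ mB.
pose A (ki : 'I_N * nat) : set (X ki.1) := llr theta1 L theta @^-1` B ki.2.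
have mA ki : measurable (A ki).
  by rewrite -[X in measurable X]setTI; exact: measurable_llr.
have := @xi_indep (map (pair k) J) A; rewrite map_inj_uniq ?uJ; last by move=> i j [].
move=> /(_ isT mA); rewrite big_map/= => <-; congr (P _).
apply/seteqP; split=> w /= H => [ki /mapP[i iJ ->]/=|i iJ]; first exact: H.
exact: (H (k, i) (map_f (pair k) iJ)).
Qed.

Lemma mgf_gt0_agent k t : 0 < mgf k t.
Proof. exact: mgf_gt0 (mY k 0) (mgf_signal k 0) (integrable_llr k 0) (mean_llr k 0) t. Qed.

Lemma slope_nondecreasing_agent k :
  {homo slope (fun t => ln (mgf k t)) (drift theta1 mu f L k theta) : x y / x <= y}.
Proof.
apply: slope_nondecreasing.
- exact: ln_mgf_scale (mY k 0) (mgf_signal k 0) (integrable_llr k 0) (mean_llr k 0).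
- exact: ln_mgf_ge (mY k 0) (mgf_signal k 0) (integrable_llr k 0) (mean_llr k 0).
Qed.

(* If x_{k,i}(theta) is almost surely nonnegative, then L(.|theta) <=
   L(.|theta1) almost everywhere; both have integral 1, so they agree. *)
Lemma llr_ae0 k : (\int[P]_w (Num.max 0 (- llr theta1 L theta (xi k 0 w)))%:E = 0)%E ->
  {ae mu k, forall x, llr theta1 L theta x = 0}.
Proof.
have mllr := @measurable_llr k.
have mneg : measurable_fun setT (fun x : X k => (Num.max 0 (- llr theta1 L theta x))%:E).
  by apply/measurable_EFinP; apply: measurable_maxr => //; exact: measurableT_comp.
have neg0 (x : X k) : (0 <= (Num.max 0 (- llr theta1 L theta x))%:E)%E.
  by rewrite lee_fin le_max lexx.
rewrite (@expectation_signal k 0 (fun x => (Num.max 0 (- llr theta1 L theta x))%:E))//.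
move=> I0.
have mfneg : measurable_fun setT
    (fun x : X k => (f k x)%:E * (Num.max 0 (- llr theta1 L theta x))%:E)%E.
  by apply: emeasurable_funM => //; exact/measurable_EFinP.
have [mL L0 IL _] := L_density k theta; have [mL1 L10 IL1 _] := L_density k theta1.
have ae1 : {ae mu k, forall x, L k theta x <= L k theta1 x}.
  have /(ae_eq_integral_abs _ measurableT mfneg) : (\int[mu k]_x
      `|(f k x)%:E * (Num.max 0 (- llr theta1 L theta x))%:E| = 0)%E.
    rewrite -I0; apply: eq_integral => x _.
    by rewrite gee0_abs// mule_ge0// lee_fin.
  apply: filterS => x /(_ I)/= /eqP; rewrite -EFinM eqe mulf_eq0 (density_eq0 theta).
  (* Where f vanishes, so does L(.|theta), and the inequality is trivial. *)
  move=> /orP[/eqP Lx0|]; first by rewrite Lx0.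
  rewrite eq_le le_max lexx andbT ge_max lexx/= oppr_le0 llrE subr_ge0.
  have [->//|Lx] := eqVneq (L k theta x) 0.
  have L1x : L k theta1 x != 0 by rewrite -density_eq0 (density_eq0 theta).
  by rewrite ler_ln ?posrE ?lt0r ?L0 ?L10 ?Lx ?L1x.
pose g x := Num.max 0 (L k theta1 x - L k theta x).
have mg : measurable_fun setT g.
  by apply: measurable_maxr => //; exact: measurable_funB.
have g0 x : 0 <= g x by rewrite le_max lexx.
have Ig : (\int[mu k]_x `|(g x)%:E| = 0)%E.
  under eq_integral do rewrite gee0_abs ?lee_fin//.
  have : (\int[mu k]_x (L k theta1 x)%:E =
      \int[mu k]_x ((L k theta x)%:E + (g x)%:E))%E.
    apply: ge0_ae_eq_integral => //.
    - exact/measurable_EFinP.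
    - by apply: emeasurable_funD; exact/measurable_EFinP.
    - by move=> x _; rewrite lee_fin.
    - by move=> x _; rewrite adde_ge0 ?lee_fin.
    - apply: filterS ae1 => x Lx _; rewrite -EFinD; congr (_%:E).
      by rewrite /g max_r ?subr_ge0// addrC subrK.
  rewrite ge0_integralD//; last 4 first.
  - by move=> x _; rewrite lee_fin.
  - exact/measurable_EFinP.
  - by move=> x _; rewrite lee_fin.
  - exact/measurable_EFinP.
  rewrite IL IL1; case: (\int[_]_x _)%E => [r| |]//=.
  by rewrite -EFinD => -[r0]; congr (_%:E); lra.
have mEg : measurable_fun setT (EFin \o g) by exact/measurable_EFinP.
have /(ae_eq_integral_abs _ measurableT mEg) ag := Ig.
apply: filterS2 ae1 ag => x Lx /(_ I) /= [gx].
have -> : llr theta1 L theta x = ln (L k theta1 x) - ln (L k theta x) by exact: llrE.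
move: gx; rewrite /g max_r ?subr_ge0// => /eqP; rewrite subr_eq0 => /eqP ->.
by rewrite subrr.
Qed.

Lemma subgradient_rate k : subgradient (rate k)
  (slope (fun t => ln (mgf k t)) (drift theta1 mu f L k theta)).
Proof. exact: subgradient_integral0 (slope_nondecreasing_agent k). Qed.

(** The almost everywhere statement is carried from the reference measure to P by the integral of
    |llr|. *)
Lemma signal_ae0 k i : {ae mu k, forall x, llr theta1 L theta x = 0} ->
  {ae P, forall w, llr theta1 L theta (xi k i w) = 0}.
Proof.
move=> ae0; have mllr := @measurable_llr k.
have mabs : measurable_fun setT (fun x : X k => `|llr theta1 L theta x|%:E).
  by apply/measurable_EFinP; exact: measurableT_comp.
have I0 : (\int[P]_w `|(llr theta1 L theta (xi k i w))%:E| = 0)%E.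
  rewrite (@expectation_signal k i (fun x => `|llr theta1 L theta x|%:E))//.
  transitivity (\int[mu k]_x (cst 0 x : \bar R))%E; last exact: integral0_eq.
  apply: ge0_ae_eq_integral => //.
  - by apply: emeasurable_funM => //; exact/measurable_EFinP.
  - by move=> x _; rewrite mule_ge0 ?lee_fin.
  - by apply: filterS ae0 => x -> _; rewrite normr0 mule0.
have mE : measurable_fun setT (fun w => (llr theta1 L theta (xi k i w))%:E).
  by apply/measurable_EFinP; exact: mY.
have /(ae_eq_integral_abs _ measurableT mE) := I0.
by apply: filterS => w /(_ I) [].
Qed.

(** The witness is [minimizer] when ln M is positive somewhere left of 0, and 0 in the degenerate
    case. The last two clauses are what the upper and the lower bound on Phi use, respectively. *)
Lemma Phi_ncE k : exists ts, [/\ ts <= 0,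
  Phi_nc theta1 L xi k theta = (- rate k ts)%:E,
  forall t, t <= 0 -> rate k ts <= rate k t &
  forall t, ts <= t -> t <= 0 -> rate k t <= 0].
Proof.
have indep := mutually_independent_llr k.
have mgfE := mgf_signal k.
have sub := subgradient_rate k; have r0 : rate k 0 = 0 by exact: integral00.
have scale := ln_mgf_scale (mY k 0) (mgfE 0) (integrable_llr k 0) (mean_llr k 0).
have M0 : mgf k 0 = 1 := mgf0 (mgfE 0).
have driftle := ln_mgf_ge (mY k 0) (mgfE 0) (integrable_llr k 0) (mean_llr k 0).
have [[t0 [t0neg Lt0]]|none] := pselect (exists t0, t0 < 0 /\ 0 < ln (mgf k t0)).
  exists (minimizer (mgf k)); split.
  - exact: (minimizer_le0 M0 scale t0neg Lt0).
  - rewrite /Phi_nc EFinN; congr (- _)%E; apply/cvg_lim => //.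
    exact: (iid_rate (mY k) indep mgfE (integrable_llr k 0) (mean_llr k 0) sub r0 t0neg Lt0).
  - exact: (minimizerP M0 scale driftle sub t0neg Lt0).
  - exact: (phi_le0_minimizer M0 scale driftle sub r0 t0neg Lt0).
have M1 t : t < 0 -> mgf k t <= 1.
  move=> t0; rewrite leNgt; apply/negP => Mt; apply: none; exists t.
  by split => //; exact: ln_gt0.
have ae0 := llr_ae0 (mgf_le1_negpart0 (mY k 0) (mgfE 0) M1).
have Y0 i := signal_ae0 i ae0.
have mgf1 t : mgf k t = 1.
  apply: EFin_inj; rewrite -(mgfE 0).
  transitivity (\int[P]_w (cst 1 w : \bar R))%E; last first.
    by rewrite integral_cst// mul1e; exact: probability_setT.
  apply: ge0_ae_eq_integral => //.
    apply/measurable_EFinP; apply: measurableT_comp => //.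
    by apply: measurable_funM => //; exact: (mY k 0).
  by apply: filterS (Y0 0) => w -> _; rewrite mulr0 expR0.
have drift0 : drift theta1 mu f L k theta = 0.
  have := driftle 1; have := driftle (- 1).
  by rewrite !mgf1 ln1 mulrN mulr1 => h1 h2; apply/eqP; rewrite eq_le h2 -oppr_le0.
have slope0 s : slope (fun t => ln (mgf k t)) (drift theta1 mu f L k theta) s = 0.
  by rewrite /slope drift0 mgf1 ln1 mul0r if_same.
have rate0 t : rate k t = 0.
  have := sub t 0; have := sub 0 t; rewrite !slope0 !mul0r !addr0 r0 => h1 h2.
  by apply/eqP; rewrite eq_le h1 h2.
exists 0; split => //.
- rewrite /Phi_nc rate0 oppr0 -[RHS]oppe0; congr (- _)%E; apply/cvg_lim => //.
  exact: (iid_rate_trivial (mY k) Y0).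
- by move=> t _; rewrite !rate0.
- by move=> t _ _; rewrite !rate0.
Qed.

Lemma Lambda_ln_mgf k t : Lambda theta1 mu f L k theta t = (ln (mgf k t))%:E.
Proof. by rewrite /Lambda expect_mgf lne_EFin// mgf_gt0_agent. Qed.

Context (w : 'rV[R]_N) (w_gt0 : forall k, 0 < w ord0 k).

(** In place of a change of variables in each integral: both sides vanish at 0 and share the
    subgradient g. *)
Lemma phi_sum_rate t : phi theta1 mu f L w theta t =
  \sum_(k < N) rate k (w ord0 k * t).
Proof.
pose s k := slope (fun t => ln (mgf k t)) (drift theta1 mu f L k theta).
pose g x := \sum_(k < N) w ord0 k * s k (w ord0 k * x).
have gmono : {homo g : x y / x <= y}.
  move=> x y xy; apply: ler_sum => k _; rewrite ler_wpM2l ?(ltW (w_gt0 k))//.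
  by apply: slope_nondecreasing_agent; rewrite ler_wpM2l ?(ltW (w_gt0 k)).
rewrite /phi (eq_integral0 gmono) => [|x x0]; last first.
  rewrite /quot0 (negPf x0) /Lambda_ave.
  under eq_bigr do rewrite Lambda_ln_mgf.
  rewrite sumEFin /= mulr_suml; apply: eq_bigr => k _.
  have wk : w ord0 k != 0 by rewrite gt_eqF.
  by rewrite /s /slope mulf_eq0 (negPf wk) (negPf x0)/=; field; rewrite x0 wk.
apply: (@subgradient_unique _ _ (fun t => \sum_(k < N) rate k (w ord0 k * t)) g).
- exact: subgradient_integral0.
- move=> a b; rewrite /g mulr_suml -big_split/=; apply: ler_sum => k _.
  apply: le_trans (subgradient_rate k (w ord0 k * a) (w ord0 k * b)).
  by rewrite -/(s k) -mulrBr le_eqVlt; apply/orP; left; apply/eqP; ring.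
- by rewrite integral00 big1// => k _; rewrite mulr0 /rate integral00.
Qed.

(** The subgradient of each [rate] at 0 is the drift. *)
Lemma phi_ge_m_ave t : m_ave theta1 mu f L w theta * t <= phi theta1 mu f L w theta t.
Proof.
rewrite phi_sum_rate /m_ave mulr_suml; apply: ler_sum => k _.
have := subgradient_rate k (w ord0 k * t) 0.
by rewrite {1}/rate integral00 /slope eqxx subr0 add0r; apply: le_trans; lra.
Qed.

End agent.

(** * Two-sided bounds on the cooperative exponent *)

Local Open Scope ereal_scope.

Theorem theorem2 (R : realType) (N : nat) (Theta : finType) (theta1 : Theta)
  (d : 'I_N -> measure_display) (X : forall k, measurableType (d k))
  (mu : forall k, {sigma_finite_measure set (X k) -> \bar R})
  (supp : forall k, set (X k))
  (f : forall k, X k -> R) (L : forall k, Theta -> X k -> R)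
  (dO : measure_display) (Omega : measurableType dO) (P : probability Omega R)
  (xi : forall k, nat -> {RV P >-> X k})
  (f_density : forall k, is_density (mu k) (supp k) (f k))
  (L_density : forall k theta, is_density (mu k) (supp k) (L k theta))
  (xi_law : forall k i (A : set (X k)), measurable A ->
     distribution P (xi k i) A = \int[mu k]_(x in A) (f k x)%:E)
  (xi_indep : mutually_independent P
     (fun (ki : 'I_N * nat) (w : Omega) => xi ki.1 ki.2 w))
  (KL_finite : forall k theta, KL (mu k) (f k) (L k theta) \is a fin_num)
  (Lambda_finite : forall k theta t, theta != theta1 ->
     Lambda theta1 mu f L k theta t < +oo)
  (identifiability : identifiable theta1 mu f L)
  (w : 'rV[R]_N) (Perron_w : Perron theta1 mu f L w) :
  (forall theta, theta != theta1 ->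
     \big[mine/+oo]_(k < N) Phi_nc theta1 L xi k theta
       <= Phi theta1 mu f L w theta /\
     Phi theta1 mu f L w theta
       <= \sum_(k < N) Phi_nc theta1 L xi k theta) /\
  \big[mine/+oo]_(theta | theta != theta1)
      \big[mine/+oo]_(k < N) Phi_nc theta1 L xi k theta
    <= Phi_min theta1 mu f L w /\
  Phi_min theta1 mu f L w
    <= \big[mine/+oo]_(theta | theta != theta1)
         \sum_(k < N) Phi_nc theta1 L xi k theta.
Proof.
have [w_sum w_gt0 w_ave] := Perron_w.
(* Weights that sum to 1 need an agent; the maximum of the rescaled minimizers is then attained. *)
have N_gt0 : (0 < N)%N.
  case: (posnP N) => // N0; subst N; move: w_sum; rewrite big_ord0 => /eqP.
  by rewrite eq_sym oner_eq0.
suff main theta : theta != theta1 ->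
    \big[mine/+oo]_(k < N) Phi_nc theta1 L xi k theta <= Phi theta1 mu f L w theta /\
    Phi theta1 mu f L w theta <= \sum_(k < N) Phi_nc theta1 L xi k theta.
  split; first exact: main.
  by split; apply: le_bigmin2 => theta /main [].
move=> theta_neq.
have Lambda_fin k t : Lambda theta1 mu f L k theta t < +oo by exact: Lambda_finite.
pose r := rate theta1 mu f L theta.
have phiE t : phi theta1 mu f L w theta t = (\sum_(k < N) r k (w ord0 k * t))%R.
  exact: (phi_sum_rate f_density L_density xi_law Lambda_fin w_gt0).
have /choice[ts tsP] : forall k, exists ts, [/\ (ts <= 0)%R,
    Phi_nc theta1 L xi k theta = (- r k ts)%:E,
    forall t, (t <= 0)%R -> (r k ts <= r k t)%R &
    forall t, (ts <= t)%R -> (t <= 0)%R -> (r k t <= 0)%R].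
  exact: (Phi_ncE f_density L_density xi_law xi_indep Lambda_fin).
split.
  (* The largest rescaled minimizer ts k / w k lies to the right of all others,
     so there the terms of the other agents are nonpositive. *)
  have [j _ jmax] := arg_maxP (fun k => ts k / w ord0 k)%R (isT : xpredT (Ordinal N_gt0)).
  set t := (ts j / w ord0 j)%R in jmax.
  have [tsj0 PhiE _ _] := tsP j.
  apply: (@le_trans _ _ (Phi_nc theta1 L xi j theta)); first exact: bigmin_le.
  rewrite PhiE /Phi EFinN leeN2; apply: ereal_inf_le.
  exists (phi theta1 mu f L w theta t)%:E; first by exists t.
  rewrite lee_fin phiE (bigD1 j)//= /t mulrC divfK ?gt_eqF//.
  rewrite gerDl; apply: sumr_le0 => k _.
  have [_ _ _ le0] := tsP k; apply: le0.
    by rewrite mulrC -ler_pdivrMr//; exact: jmax.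
  by rewrite mulr_ge0_le0 ?(ltW (w_gt0 k))// mulr_le0_ge0// invr_ge0 ltW.
have -> : \sum_(k < N) Phi_nc theta1 L xi k theta = (- \sum_(k < N) r k (ts k))%:E.
  by rewrite -sumrN -sumEFin; apply: eq_bigr => k _; have [_ ->] := tsP k.
rewrite /Phi EFinN leeN2; apply: le_ereal_inf_tmp => _ [t _ <-].
rewrite lee_fin; have [t_le0|t_gt0] := leP t 0%R.
  rewrite phiE; apply: ler_sum => k _; have [_ _ min _] := tsP k; apply: min.
  by rewrite mulr_ge0_le0// ltW.
apply: (@le_trans _ _ 0%R).
  apply: sumr_le0 => k _; have [_ _ min _] := tsP k.
  by apply: le_trans (min 0%R (lexx _)) _; rewrite /r /rate integral00.
apply: le_trans (phi_ge_m_ave f_density L_density xi_law Lambda_fin w_gt0 t).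
by rewrite mulr_ge0// ltW// w_ave.
Qed.
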